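(* Let $Z=z_1e_1+z_2e_2$ and $\mathcal V=\nu_1e_1+\nu_2e_2=\alpha_1+j\alpha_2$ be elements of $\mathbb{BC}$ with $\Re(\alpha_1)+\frac12>|\Im(\alpha_2)|$. Then $$\mathcal J_{\mathcal V}(Z)=\frac{Z^{\mathcal V}}{2^{\mathcal V-1}\sqrt{\pi}\,\Gamma_b\left(\mathcal V+\frac12\right)}\sum_{s=0}^{\infty}\frac{(-1)^s}{\Gamma(2s+1)}\int_D(\cos t)^{2\mathcal V}(Z\sin t)^{2s}\,dt,$$ where $D=(D_1(t_1),D_2(t_2))$ is the curve in $\mathbb{BC}$ with $t=t_1e_1+t_2e_2$, $0\le t_1,t_2\le\frac{\pi}{2}$.
   Context: Bicomplex numbers: $\mathbb{BC}=\{\lambda_1+j\lambda_2:\lambda_1,\lambda_2\in\mathbb C(i)\}$ with commuting units $i,j$, $i^2=j^2=-1$, $k=ij$, $k^2=1$. Put $e_1=\frac{1+k}{2}$, $e_2=\frac{1-k}{2}$; then $e_1+e_2=1$, $e_l^2=e_l$, $e_1e_2=0$. Every $Z=\lambda_1+j\lambda_2$ has the unique idempotent representation $Z=z_1e_1+z_2e_2$ with $z_1=\lambda_1-i\lambda_2$, $z_2=\lambda_1+i\lambda_2\in\mathbb C(i)$. In particular $\nu_1=\alpha_1-i\alpha_2$, $\nu_2=\alpha_1+i\alpha_2$. Elementary functions act componentwise: $\cos t=\cos t_1\,e_1+\cos t_2\,e_2$, and similarly for $\sin$. $Z^{\mathcal V}=z_1^{\nu_1}e_1+z_2^{\nu_2}e_2$,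 with complex powers $z^\nu=\exp(\nu\log z)$ for a fixed branch of $\log$ used consistently (the real branch for positive reals; at $z=0$ only when the power makes sense). $\Gamma_b(Z)=\Gamma(z_1)e_1+\Gamma(z_2)e_2$, with $1/\Gamma$ read as an entire function. Integration is componentwise: for $D=(D_1,D_2)$ and $g(t)=g_1(t_1)e_1+g_2(t_2)e_2$, $\int_D g(t)\,dt=\left(\int_{D_1}g_1(t_1)dt_1\right)e_1+\left(\int_{D_2}g_2(t_2)dt_2\right)e_2$; here $D_1,D_2$ are the real interval $[0,\pi/2]$. Bicomplex Bessel function: for $\mathcal V,Z\in\mathbb{BC}$, $$\mathcal J_{\mathcal V}(Z)=\sum_{s=0}^\infty\frac{(-1)^s}{\Gamma_b(\mathcal V+s+1)s!}\left(\frac Z2\right)^{\mathcal V+2s},$$ equivalently $\mathcal J_{\mathcal V}(Z)=J_{\nu_1}(z_1)e_1+J_{\nu_2}(z_2)e_2$ with $J_\nu$ the classical Bessel function of the first kind. *)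

(* Defs.v *)
From Stdlib Require Import Reals Lra Factorial ClassicalEpsilon.
From Coquelicot Require Import Coquelicot.

Open Scope R_scope.

(** * Complex functions *)

Definition Cexp (z : C) : C :=
  (exp (Re z) * cos (Im z), exp (Re z) * sin (Im z)).

Definition Ccos (z : C) : C := ((Cexp (Ci * z) + Cexp (- (Ci * z))) / 2)%C.
Definition Csin (z : C) : C :=
  ((Cexp (Ci * z) - Cexp (- (Ci * z))) / (2 * Ci))%C.

(** Branches of the logarithm: the argument is taken in a fixed half-open
    interval of length [2 * PI], closed on either side, and the branch is the
    real logarithm on the positive reals.  At [0] the value is irrelevant. *)
Definition log_branch (log : C -> C) : Prop :=
  (forall z : C, z <> RtoC 0 -> Cexp (log z) = z) /\
  (forall x : R, 0 < x -> log (RtoC x) = RtoC (ln x)) /\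
  (exists a : R,
     (forall z : C, z <> RtoC 0 -> a < Im (log z) <= a + 2 * PI) \/
     (forall z : C, z <> RtoC 0 -> a <= Im (log z) < a + 2 * PI)).

Definition principal_log (z : C) : C :=
  (ln (Cmod z),
   if Rle_dec 0 (Im z) then acos (Re z / Cmod z) else - acos (Re z / Cmod z)).

Lemma principal_log_branch : log_branch principal_log.
Proof.
assert (key : forall z : C, z <> RtoC 0 ->
  0 < Cmod z /\ -1 <= Re z / Cmod z <= 1 /\
  Cmod z * sqrt (1 - (Re z / Cmod z)²) = Rabs (Im z)).
{ intros z Hz.
  assert (Hm : 0 < Cmod z) by now apply Cmod_gt_0.
  assert (H2 := Cmod2_alt z).
  split; [easy|]; split.
  - assert (A := re_le_Cmod z).
    assert (B := Rle_abs (Re z)). assert (B' := Rle_abs (- Re z)).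
    rewrite Rabs_Ropp in B'.
    split; apply (Rmult_le_reg_r (Cmod z)); trivial; field_simplify; lra.
  - rewrite <- (sqrt_Rsqr (Cmod z)) at 1 by lra.
    rewrite <- sqrt_mult_alt by apply Rle_0_sqr.
    rewrite <- sqrt_Rsqr_abs; f_equal.
    unfold Rsqr; field_simplify; lra. }
split; [|split].
- intros z Hz; destruct (key z Hz) as (Hm & Hb & Hs).
  assert (Hc : cos (Im (principal_log z)) = Re z / Cmod z).
  { unfold principal_log; cbn [Im snd].
    destruct (Rle_dec 0 (Im z)); rewrite ?cos_neg; now apply cos_acos. }
  assert (Hn : Cmod z * sin (Im (principal_log z)) = Im z).
  { unfold principal_log; cbn [Im snd].
    destruct (Rle_dec 0 (Im z)); rewrite ?sin_neg, ?Ropp_mult_distr_r_reverse,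
      sin_acos, Hs by easy; [now apply Rabs_pos_eq|rewrite Rabs_left; lra]. }
  unfold Cexp; rewrite Hc; change (Re (principal_log z)) with (ln (Cmod z)).
  rewrite exp_ln, Hn by easy.
  apply injective_projections; cbn [fst snd]; [|easy].
  change (fst z) with (Re z); field; lra.
- intros x Hx; unfold principal_log; rewrite Cmod_R, Rabs_pos_eq by lra.
  cbn [RtoC Re Im fst snd]; destruct (Rle_dec 0 0) as [_|n]; [|now elim n; right].
  replace (x / x) with 1 by (field; lra); now rewrite acos_1.
- exists (- PI); left; intros z Hz; destruct (key z Hz) as (Hm & Hb & Hs).
  unfold principal_log; cbn [Im snd].
  assert (B := acos_bound (Re z / Cmod z)); assert (P := PI_RGT_0).
  destruct (Rle_dec 0 (Im z)) as [|n]; [lra|].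
  cut (acos (Re z / Cmod z) <> PI); [lra|intros E].
  assert (S := sin_acos _ Hb); rewrite E, sin_PI in S.
  rewrite <- S, Rmult_0_r in Hs.
  revert Hs; rewrite Rabs_left; lra.
Qed.

(** [z ^ nu = exp (nu log z)].  At [z = 0] the power makes sense for [nu = 0]
    (value 1) and for [Re nu > 0] (value 0); 0 is also the dummy value in the
    remaining cases. *)
Definition Cpower (log : C -> C) (z nu : C) : C :=
  if Ceq_dec z 0 then (if Ceq_dec nu 0 then RtoC 1 else RtoC 0)
  else Cexp (nu * log z).

Definition CLim_seq (u : nat -> C) : C :=
  (real (Lim_seq (fun n => Re (u n))), real (Lim_seq (fun n => Im (u n)))).

Definition CSeries (a : nat -> C) : C :=
  (Series (fun n => Re (a n)), Series (fun n => Im (a n))).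

(** [z (z + 1) ... (z + n - 1)] *)
Fixpoint Crising (z : C) (n : nat) : C :=
  match n with
  | O => RtoC 1
  | S m => (Crising z m * (z + INR m))%C
  end.

(** The entire function [1 / Gamma], by Gauss's product
    [1 / Gamma z = lim z (z + 1) ... (z + n) / (n! n ^ z)]. *)
Definition rGamma (z : C) : C :=
  CLim_seq (fun n =>
    (Crising z (S n) / (INR (fact n) * Cexp (z * ln (INR n))))%C).

(** Meaningful away from the poles [0, -1, -2, ...], where [rGamma] is 0. *)
Definition Gamma (z : C) : C := (/ rGamma z)%C.

(** * Bicomplex numbers *)

(** [(l1, l2)] stands for [l1 + j l2], with [l1], [l2] in [C(i)]. *)
Definition BC : Type := (C * C)%type.

Definition CtoBC (l : C) : BC := (l, RtoC 0).
Definition BCj : BC := (RtoC 0, RtoC 1).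

Definition BCplus (Z W : BC) : BC :=
  ((fst Z + fst W)%C, (snd Z + snd W)%C).
Definition BCopp (Z : BC) : BC := ((- fst Z)%C, (- snd Z)%C).
Definition BCminus (Z W : BC) : BC := BCplus Z (BCopp W).
Definition BCmult (Z W : BC) : BC :=
  ((fst Z * fst W - snd Z * snd W)%C, (fst Z * snd W + snd Z * fst W)%C).

Declare Scope BC_scope.
Delimit Scope BC_scope with BC.
Bind Scope BC_scope with BC.
Infix "+" := BCplus : BC_scope.
Infix "-" := BCminus : BC_scope.
Infix "*" := BCmult : BC_scope.
Notation "- Z" := (BCopp Z) : BC_scope.

Fixpoint BCpow (Z : BC) (n : nat) : BC :=
  match n with
  | O => CtoBC 1
  | S m => (Z * BCpow Z m)%BC
  end.

Definition BCk : BC := (CtoBC Ci * BCj)%BC.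
Definition e1 : BC := (CtoBC (1 / 2)%R * (CtoBC 1 + BCk))%BC.
Definition e2 : BC := (CtoBC (1 / 2)%R * (CtoBC 1 - BCk))%BC.

Definition BCidem (z1 z2 : C) : BC := (CtoBC z1 * e1 + CtoBC z2 * e2)%BC.
Definition idem1 (Z : BC) : C := (fst Z - Ci * snd Z)%C.
Definition idem2 (Z : BC) : C := (fst Z + Ci * snd Z)%C.

Lemma BCj_sqr : (BCj * BCj)%BC = CtoBC (-1).
Proof.
unfold BCj, BCmult, CtoBC; simpl.
apply injective_projections; simpl; ring.
Qed.

Lemma BCidemE (z1 z2 : C) :
  BCidem z1 z2 =
  (((1 / 2)%R * (z1 + z2))%C, ((1 / 2)%R * (Ci * (z1 - z2)))%C).
Proof.
unfold BCidem, e1, e2, BCk, BCj, CtoBC, BCplus, BCminus, BCopp, BCmult.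
apply injective_projections; simpl; ring.
Qed.

Lemma idem1_BCidem (z1 z2 : C) : idem1 (BCidem z1 z2) = z1.
Proof.
rewrite BCidemE; unfold idem1; simpl.
destruct z1, z2; apply injective_projections; simpl; field.
Qed.

Lemma idem2_BCidem (z1 z2 : C) : idem2 (BCidem z1 z2) = z2.
Proof.
rewrite BCidemE; unfold idem2; simpl.
destruct z1, z2; apply injective_projections; simpl; field.
Qed.

Lemma BCidem_repr (Z : BC) : BCidem (idem1 Z) (idem2 Z) = Z.
Proof.
rewrite BCidemE; unfold idem1, idem2.
destruct Z as [[a b] [c d]].
apply injective_projections; simpl; apply injective_projections; simpl; field.
Qed.

Lemma idem1_mult (Z W : BC) : idem1 (Z * W)%BC = (idem1 Z * idem1 W)%C.
Proof.
destruct Z as [[a b] [c d]], W as [[p q] [r s]].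
apply injective_projections; simpl; ring.
Qed.

Lemma idem2_mult (Z W : BC) : idem2 (Z * W)%BC = (idem2 Z * idem2 W)%C.
Proof.
destruct Z as [[a b] [c d]], W as [[p q] [r s]].
apply injective_projections; simpl; ring.
Qed.

(** The inverse of [Z] when both idempotent components are nonzero. *)
Definition BCinv (Z : BC) : BC := BCidem (/ idem1 Z) (/ idem2 Z).
Definition BCdiv (Z W : BC) : BC := (Z * BCinv W)%BC.
Infix "/" := BCdiv : BC_scope.

Definition BCcos (t : BC) : BC := BCidem (Ccos (idem1 t)) (Ccos (idem2 t)).
Definition BCsin (t : BC) : BC := BCidem (Csin (idem1 t)) (Csin (idem2 t)).

Definition BCpower (log : C -> C) (Z V : BC) : BC :=
  BCidem (Cpower log (idem1 Z) (idem1 V)) (Cpower log (idem2 Z) (idem2 V)).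

Definition BCGamma (Z : BC) : BC :=
  BCidem (Gamma (idem1 Z)) (Gamma (idem2 Z)).
Definition BCrGamma (Z : BC) : BC :=
  BCidem (rGamma (idem1 Z)) (rGamma (idem2 Z)).

(** ** Series *)

Definition ex_BCSeries (a : nat -> BC) : Prop :=
  @ex_series C_AbsRing
    (prod_NormedModule C_AbsRing C_NormedModule C_NormedModule) a.

Definition BCSeries (a : nat -> BC) : BC :=
  (CSeries (fun s => fst (a s)), CSeries (fun s => snd (a s))).

(** ** Integrals *)

(** Improper at both ends, so as to allow integrands that are unbounded near
    an endpoint. *)
Definition is_CInt (f : R -> C) (a b : R) (I : C) : Prop :=
  @is_RInt_gen C_R_NormedModule f (at_right a) (at_left b) I.

(** [I] is the integral over [D = ([a1, b1], [a2, b2])] of a function [g] of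
    the form [g (t1 e1 + t2 e2) = g1 t1 e1 + g2 t2 e2]. *)
Definition is_BCInt (g : BC -> BC) (a1 b1 a2 b2 : R) (I : BC) : Prop :=
  exists (g1 g2 : R -> C) (I1 I2 : C),
    (forall t1 t2 : R, a1 <= t1 <= b1 -> a2 <= t2 <= b2 ->
       g (BCidem t1 t2) = BCidem (g1 t1) (g2 t2)) /\
    is_CInt g1 a1 b1 I1 /\ is_CInt g2 a2 b2 I2 /\
    I = BCidem I1 I2.

Definition ex_BCInt (g : BC -> BC) (a1 b1 a2 b2 : R) : Prop :=
  exists I : BC, is_BCInt g a1 b1 a2 b2 I.

Definition BCInt (g : BC -> BC) (a1 b1 a2 b2 : R) : BC :=
  epsilon (inhabits (CtoBC 0)) (is_BCInt g a1 b1 a2 b2).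

Lemma BCInt_unique (g : BC -> BC) (a1 b1 a2 b2 : R) (I : BC) :
  a1 < b1 -> a2 < b2 -> is_BCInt g a1 b1 a2 b2 I -> BCInt g a1 b1 a2 b2 = I.
Proof.
assert (uniq : forall (f h : R -> C) (a b : R) (I J : C), a < b ->
  (forall t, a <= t <= b -> f t = h t) ->
  is_CInt f a b I -> is_CInt h a b J -> I = J).
{ intros f h a b I0 J0 ab fh HI HJ.
  assert (HI' : is_CInt h a b I0).
  { revert HI; apply is_RInt_gen_ext.
    apply Filter_prod with (fun x => a < x < (a + b) / 2)
      (fun x => (a + b) / 2 < x < b).
    - assert (d : 0 < (b - a) / 2) by lra.
      exists (mkposreal _ d); intros y Hy ay.
      apply Rabs_def2 in Hy; unfold minus, plus, opp in Hy; simpl in Hy; lra.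
    - assert (d : 0 < (b - a) / 2) by lra.
      exists (mkposreal _ d); intros y Hy ay.
      apply Rabs_def2 in Hy; unfold minus, plus, opp in Hy; simpl in Hy; lra.
    - intros x y Hx Hy t Ht; simpl in Ht.
      rewrite Rmin_left, Rmax_right in Ht by lra; apply fh; lra. }
  assert (U := @is_RInt_gen_unique C_R_CompleteNormedModule (at_right a)
     (at_left b) _ _ h).
  now rewrite <- (U _ HI'), <- (U _ HJ). }
intros ab1 ab2 H.
assert (H' : is_BCInt g a1 b1 a2 b2 (BCInt g a1 b1 a2 b2))
  by exact (epsilon_spec _ _ (ex_intro _ I H)).
destruct H as (f1 & f2 & I1 & I2 & E & HI1 & HI2 & ->).
destruct H' as (h1 & h2 & J1 & J2 & E' & HJ1 & HJ2 & ->).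
assert (EE : forall t1 t2, a1 <= t1 <= b1 -> a2 <= t2 <= b2 ->
  h1 t1 = f1 t1 /\ h2 t2 = f2 t2).
{ intros t1 t2 H1 H2; assert (Q := E _ _ H1 H2); rewrite (E' _ _ H1 H2) in Q.
  split; [apply (f_equal idem1) in Q|apply (f_equal idem2) in Q];
  now rewrite ?idem1_BCidem, ?idem2_BCidem in Q. }
f_equal.
- apply (uniq h1 f1 a1 b1); trivial; intros t Ht; apply (EE t a2); lra.
- apply (uniq h2 f2 a2 b2); trivial; intros t Ht; apply (EE a1 t); lra.
Qed.

(** ** The Bessel function *)

(** [1 / Gamma_b] is written [BCrGamma]: it also covers the poles of
    [Gamma_b]. *)
Definition BesselJ_term (log : C -> C) (V Z : BC) (s : nat) : BC :=
  (CtoBC ((-1) ^ s)%R * BCrGamma (V + CtoBC (INR s) + CtoBC 1)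
     / CtoBC (INR (fact s))
     * BCpower log (Z / CtoBC 2) (V + CtoBC (2 * INR s)%R))%BC.

Definition BesselJ (log : C -> C) (V Z : BC) : BC :=
  BCSeries (BesselJ_term log V Z).

(* Main.v *)
Require Import Defs.
From Stdlib Require Import Reals Lra Lia Factorial.
From Coquelicot Require Import Coquelicot.

(** In each idempotent component the claim follows termwise from the Beta
    integral, in the form
      [1 / Gamma (nu + 1/2) * int_0^(pi/2) cos^(2 nu) sin^(2 s)
         = 1 / Gamma (nu + s + 1) * sqrt pi / 2 * (2 s)! / (4^s s!)],
    which involves no [Gamma] but only the entire function [1 / Gamma].
    The derivative of [sin^(2 s + 1) cos^(w + 1)] gives a recurrence in [s]
    and one in [w]; the first reduces to [s = 0].  Iterating the second,
    [I (2 nu)] is a quotient of rising factorials times [I (2 nu + 2 n + 2)],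
    so that by Gauss's product the case [s = 0] amounts to
    [sqrt n * I (2 nu + 2 n + 2) --> sqrt pi / 2].  This is Wallis's formula
    when [nu = 0], and the difference of the two integrals is [O(1 / n)]. *)

(** Two features shape the proof. For [Re nu < 0] the factor [cos^(2 nu)] is unbounded at [PI / 2],
    so that even the existence of the integral needs an argument: it is clear for [Re w >= 1], and
    the recurrence in [w] carries it down to [Re w > -1]. And [rGamma] is Gauss's product read
    through [Lim_seq], so that its convergence has to be proved for every complex argument, zeros
    included; it follows from consecutive quotients being [1 + O(1 / n ^ 2)]. This definition also
    explains the route: rising factorials are just what iterating the recurrence yields, and the
    products at [nu + 1/2] and [nu + 1] differ in their denominators by [n ^ (1/2)], whence the
    factor [sqrt n]. The power [(Z / 2) ^ (V + 2 s)] splits for every admissible branch, because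
    halving does not change the argument. No sum is exchanged with an integral. *)

Lemma exp_le_exp (x y : R) : x <= y -> exp x <= exp y.
Proof. intros [H|H]; [left; now apply exp_increasing|right; now rewrite H]. Qed.

Lemma Cexp_plus (z w : C) : Cexp (z + w) = (Cexp z * Cexp w)%C.
Proof.
unfold Cexp; destruct z as [x y], w as [u v]; cbn [Re Im fst snd Cplus].
rewrite exp_plus, cos_plus, sin_plus.
apply injective_projections; cbn; ring.
Qed.

Lemma Cexp_RtoC (x : R) : Cexp (RtoC x) = RtoC (exp x).
Proof.
unfold Cexp; cbn; rewrite cos_0, sin_0; apply injective_projections; cbn; ring.
Qed.

Lemma Cmod_Cexp (z : C) : Cmod (Cexp z) = exp (Re z).
Proof.
assert (H := sin2_cos2 (Im z)); unfold Rsqr in H.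
apply Rsqr_inj; [apply Cmod_ge_0|left; apply exp_pos|].
rewrite !Rsqr_pow2, Cmod2_alt; unfold Cexp; cbn [Re Im fst snd].
rewrite <- (Rmult_1_r (exp (Re z) ^ 2)), <- H; ring.
Qed.

(** * Improper integrals of complex functions *)

(** Cutting at the midpoint keeps the two one-sided neighbourhoods apart, which gives [x < y]. *)
Lemma filter_prod_open (a b : R) (P : R * R -> Prop) : a < b ->
  (forall x y, a < x -> x < y -> y < b -> P (x, y)) ->
  filter_prod (at_right a) (at_left b) P.
Proof.
intros ab H; assert (d : 0 < (b - a) / 2) by lra.
apply Filter_prod with (fun x => a < x < (a + b) / 2)
  (fun x => (a + b) / 2 < x < b).
- exists (mkposreal _ d); intros y Hy ay.
  apply Rabs_def2 in Hy; unfold minus, plus, opp in Hy; simpl in Hy; lra.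
- exists (mkposreal _ d); intros y Hy ay.
  apply Rabs_def2 in Hy; unfold minus, plus, opp in Hy; simpl in Hy; lra.
- intros x y Hx Hy; apply H; lra.
Qed.

Lemma is_RInt_gen_ext_open {V : NormedModule R_AbsRing} (f g : R -> V)
  (a b : R) (I : V) : a < b ->
  (forall t, a < t < b -> f t = g t) ->
  is_RInt_gen f (at_right a) (at_left b) I ->
  is_RInt_gen g (at_right a) (at_left b) I.
Proof.
intros ab fg; apply is_RInt_gen_ext, filter_prod_open; trivial.
intros x y ax xy yb t Ht; simpl in Ht.
rewrite Rmin_left, Rmax_right in Ht by lra; apply fg; lra.
Qed.

(** On [[x, y]] inside the open interval this is the ordinary fundamental theorem. At the endpoints
    only limits of [F] enter, so [f] may be unbounded there. *)
Lemma is_RInt_gen_antiderivative {V : CompleteNormedModule R_AbsRing}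
  (F f : R -> V) (a b : R) (la lb : V) : a < b ->
  (forall x, a < x < b -> is_derive F x (f x)) ->
  (forall x, a < x < b -> continuous f x) ->
  filterlim F (at_right a) (locally la) ->
  filterlim F (at_left b) (locally lb) ->
  is_RInt_gen f (at_right a) (at_left b) (minus lb la).
Proof.
intros ab HF Hf Ha Hb P HP.
assert (L : filterlim (fun xy : R * R => minus (F (snd xy)) (F (fst xy)))
  (filter_prod (at_right a) (at_left b)) (locally (minus lb la))).
{ unfold minus; eapply filterlim_comp_2; [| |apply (filterlim_plus (V := V))].
  - eapply filterlim_comp; [apply filterlim_snd|exact Hb].
  - eapply filterlim_comp; [|apply (filterlim_opp (V := V))].
    eapply filterlim_comp; [apply filterlim_fst|exact Ha]. }
assert (Q : filter_prod (at_right a) (at_left b)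
  (fun xy => a < fst xy /\ fst xy < snd xy /\ snd xy < b))
  by now apply filter_prod_open.
assert (LP := L P HP); unfold filtermap in LP.
unfold filtermapi; generalize (filter_and _ _ LP Q); apply filter_imp.
intros [x y]; simpl; intros [HPxy H].
exists (minus (F y) (F x)); split; [|exact HPxy].
apply is_RInt_derive; intros t Ht;
  rewrite Rmin_left, Rmax_right in Ht by lra; [apply HF|apply Hf]; lra.
Qed.

Lemma is_RInt_gen_continuous {V : CompleteNormedModule R_AbsRing}
  (f : R -> V) (a b : R) : a < b -> (forall x, continuous f x) ->
  is_RInt_gen f (at_right a) (at_left b) (RInt f a b).
Proof.
intros ab Hf.
assert (D : forall x, is_derive (RInt f a) x (f x)).
{ intros x; apply is_derive_RInt with a; [|apply Hf].
  apply filter_forall; intros y; apply RInt_correct, ex_RInt_continuous; auto. }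
assert (Cn : forall x, filterlim (RInt f a) (locally x) (locally (RInt f a x))).
{ intros x; apply (ex_derive_continuous (RInt f a)); eexists; apply D. }
replace (RInt f a b) with (minus (RInt f a b) (RInt f a a))
  by (rewrite RInt_point; apply (minus_zero_r (G := V))).
apply is_RInt_gen_antiderivative with (RInt f a); auto.
- eapply filterlim_filter_le_1; [apply filter_le_within|apply Cn].
- eapply filterlim_filter_le_1; [apply filter_le_within|apply Cn].
Qed.

(** [C_R_NormedModule] is a module over the reals only. Passing to components gives access to
    complex scalars, as in [is_CInt_scal], and to real integrals. *)
Lemma is_CInt_components (f : R -> C) (a b : R) (I : C) :
  is_CInt f a b I <->
  is_RInt_gen (fun t => Re (f t)) (at_right a) (at_left b) (Re I) /\
  is_RInt_gen (fun t => Im (f t)) (at_right a) (at_left b) (Im I).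
Proof.
split.
- intros H; split; intros P HP.
  + assert (HP' : @locally C_R_NormedModule I (fun z : C => P (fst z)))
      by exact (continuous_fst (U := R_UniformSpace) (V := R_UniformSpace) _ _ P HP).
    assert (H' := H _ HP'); unfold filtermapi in *; revert H'; apply filter_imp; intros xy [y [Hy Py]].
    exists (fst y); split; trivial; exact (is_RInt_fct_extend_fst _ _ _ _ Hy).
  + assert (HP' : @locally C_R_NormedModule I (fun z : C => P (snd z)))
      by exact (continuous_snd (U := R_UniformSpace) (V := R_UniformSpace) _ _ P HP).
    assert (H' := H _ HP'); unfold filtermapi in *; revert H'; apply filter_imp; intros xy [y [Hy Py]].
    exists (snd y); split; trivial; exact (is_RInt_fct_extend_snd _ _ _ _ Hy).
- intros [H1 H2] P [eps HP].
  assert (L1 := H1 _ (locally_ball (Re I) eps)).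
  assert (L2 := H2 _ (locally_ball (Im I) eps)).
  unfold filtermapi in *; generalize (filter_and _ _ L1 L2); apply filter_imp.
  intros xy [[y [Hy By]] [z [Hz Bz]]].
  exists (y, z); split; [|apply HP; split; assumption].
  now apply (is_RInt_fct_extend_pair (U := R_NormedModule) (V := R_NormedModule)).
Qed.

Lemma is_CInt_ext (f g : R -> C) (a b : R) (I : C) : a < b ->
  (forall t, a < t < b -> f t = g t) -> is_CInt f a b I -> is_CInt g a b I.
Proof. apply (is_RInt_gen_ext_open (V := C_R_NormedModule)). Qed.

Lemma is_CInt_plus (f g : R -> C) (a b : R) (I J : C) :
  is_CInt f a b I -> is_CInt g a b J ->
  is_CInt (fun t => f t + g t)%C a b (I + J)%C.
Proof. apply (is_RInt_gen_plus (V := C_R_NormedModule)). Qed.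

Lemma is_CInt_scal (c : C) (f : R -> C) (a b : R) (I : C) :
  is_CInt f a b I -> is_CInt (fun t => c * f t)%C a b (c * I)%C.
Proof.
rewrite !is_CInt_components; intros [H1 H2]; split; simpl.
- apply (is_RInt_gen_minus (fun t => fst c * Re (f t)) (fun t => snd c * Im (f t)));
  now apply (is_RInt_gen_scal (V := R_NormedModule)).
- apply (is_RInt_gen_plus (fun t => fst c * Im (f t)) (fun t => snd c * Re (f t)));
  now apply (is_RInt_gen_scal (V := R_NormedModule)).
Qed.

Lemma is_CInt_norm_le (f : R -> C) (g : R -> R) (a b : R) (I : C) (J : R) :
  a < b -> (forall t, a < t < b -> Cmod (f t) <= g t) ->
  is_CInt f a b I -> is_RInt_gen g (at_right a) (at_left b) J -> Cmod I <= J.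
Proof.
intros ab H HI HJ.
assert (X := @RInt_gen_norm C_R_CompleteNormedModule (at_right a) (at_left b)
  _ _ f g I J).
rewrite Cmod_norm; apply X; trivial.
- apply filter_prod_open; simpl; intros; lra.
- apply filter_prod_open; simpl; trivial; intros x y ax xy yb t Ht.
  assert (Y := Cmod_norm (f t)); rewrite <- H by lra; right.
  symmetry; exact Y.
Qed.

(** * Differentiation and continuity by real and imaginary parts *)

Lemma is_derive_C (f : R -> C) (x : R) (l : C) :
  is_derive (fun t => Re (f t)) x (Re l) ->
  is_derive (fun t => Im (f t)) x (Im l) ->
  @is_derive R_AbsRing C_R_NormedModule f x l.
Proof.
intros Hf Hg.
apply (filterdiff_ext_lin _ (fun y : R =>
  ((scal y (Re l), scal y (Im l)) : C_R_NormedModule))); [|reflexivity].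
apply (filterdiff_ext (fun t => ((Re (f t), Im (f t)) : C_R_NormedModule)));
  [now intros t; destruct (f t)|].
(* Pairing is linear, hence its own differential, and the chain rule in two variables applies. *)
apply (filterdiff_comp'_2 (W := C_R_NormedModule) (fun t => Re (f t))
  (fun t => Im (f t)) (fun u v => (u, v)) x
  (fun y => scal y (Re l)) (fun y => scal y (Im l)) (fun u v => (u, v))); trivial.
apply (filterdiff_ext_lin _ (fun z => z)); [|now intros [u v]].
apply (filterdiff_ext (fun z => z)); [now intros [u v]|].
apply filterdiff_id.
Qed.

Lemma continuous_C (f : R -> C) (x : R) :
  continuous (fun t => Re (f t)) x -> continuous (fun t => Im (f t)) x ->
  @continuous R_UniformSpace C_R_NormedModule f x.
Proof.
intros Hf Hg P [eps HP].
assert (L1 := Hf _ (locally_ball (Re (f x)) eps)).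
assert (L2 := Hg _ (locally_ball (Im (f x)) eps)).
unfold filtermap in *; generalize (filter_and _ _ L1 L2); apply filter_imp;
  intros y [H1 H2]; apply HP; split; assumption.
Qed.

(** * The integrals of [cos^w sin^(2 s)] *)

(** [cos t ^ w] where [cos t > 0]; elsewhere [ln] is [0] and the value is [1]. *)
Definition cospow (w : C) (t : R) : C := Cexp (w * RtoC (ln (cos t))).

Lemma cospow_plus (w v : C) (t : R) : cospow (w + v) t = (cospow w t * cospow v t)%C.
Proof. unfold cospow; rewrite <- Cexp_plus; apply f_equal; ring. Qed.

Lemma cospow_RtoC (x t : R) : cospow (RtoC x) t = RtoC (exp (x * ln (cos t))).
Proof. unfold cospow; now rewrite <- RtoC_mult, Cexp_RtoC. Qed.

Lemma cospow_1 (t : R) : 0 < cos t -> cospow (RtoC 1) t = RtoC (cos t).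
Proof. intros H; now rewrite cospow_RtoC, Rmult_1_l, exp_ln. Qed.

Lemma Cmod_cospow (w : C) (t : R) : Cmod (cospow w t) = exp (Re w * ln (cos t)).
Proof. unfold cospow; rewrite Cmod_Cexp; destruct w; f_equal; simpl; ring. Qed.

Lemma Cmod_cospow_sin_le (w : C) (k : nat) (t : R) :
  Cmod (cospow w t * (sin t ^ k)%R) <= exp (Re w * ln (cos t)).
Proof.
rewrite Cmod_mult, Cmod_cospow, Cmod_R.
assert (H : Rabs (sin t ^ k) <= 1).
{ rewrite <- RPow_abs, <- (pow1 k); apply pow_incr; split; [apply Rabs_pos|].
  apply Rabs_le, SIN_bound. }
assert (E := exp_pos (Re w * ln (cos t))); nra.
Qed.

Lemma ln_nonpos (x : R) : x <= 0 -> ln x = 0.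
Proof.
intros H; unfold ln; destruct (Rlt_dec 0 x) as [K|K]; [exfalso; lra|reflexivity].
Qed.

Lemma ln_le_0 (x : R) : x <= 1 -> ln x <= 0.
Proof.
intros H; destruct (Rlt_dec 0 x) as [K|K].
- rewrite <- ln_1; now apply ln_le.
- rewrite ln_nonpos; lra.
Qed.

Lemma ln_cos_le_0 (t : R) : ln (cos t) <= 0.
Proof. apply ln_le_0, COS_bound. Qed.

Lemma exp_mult_ln_cos_lim (p : R) : 0 < p ->
  filterlim (fun t => exp (p * ln (cos t))) (at_left (PI / 2)) (locally 0).
Proof.
intros Hp; apply filterlim_locally; intros eps.
assert (C1 : continuous cos (PI / 2)) by apply continuous_cos.
(* The threshold is [eps ^ (1 / p)]. *)
assert (C2 : locally (PI / 2) (fun t => Rabs (cos t) < exp (ln eps / p))).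
{ assert (C0 := C1 _ (locally_ball _ (mkposreal _ (exp_pos (ln eps / p))))).
  unfold filtermap in C0; revert C0; apply filter_imp.
  intros t; unfold ball; simpl; unfold AbsRing_ball, abs, minus, plus, opp; simpl.
  now rewrite cos_PI2, Ropp_0, Rplus_0_r. }
assert (C3 : locally (PI / 2) (fun t => 0 < t)).
{ apply (open_gt 0); generalize PI_RGT_0; simpl; lra. }
unfold at_left, within; generalize (filter_and _ _ C2 C3); apply filter_imp.
intros t [H1 H2] Ht.
assert (P : 0 < cos t) by (apply cos_gt_0; lra).
rewrite Rabs_pos_eq in H1 by lra.
unfold ball; simpl; unfold AbsRing_ball, abs, minus, plus, opp; simpl.
rewrite Ropp_0, Rplus_0_r, Rabs_pos_eq by (left; apply exp_pos).
apply ln_increasing in H1; trivial; rewrite ln_exp in H1.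
rewrite <- (exp_ln eps) by apply cond_pos; apply exp_increasing.
apply (Rmult_lt_compat_l p) in H1; trivial; field_simplify in H1; lra.
Qed.

Lemma filterlim_C_squeeze {T} (F : (T -> Prop) -> Prop) {FF : Filter F}
  (f : T -> C) (g : T -> R) : (forall t, Cmod (f t) <= g t) ->
  filterlim g F (locally 0) ->
  filterlim f F (@locally C_R_NormedModule (RtoC 0)).
Proof.
intros H Hg P [eps HP].
assert (L := Hg _ (locally_ball 0 eps)).
unfold filtermap in *; revert L; apply filter_imp.
intros t; unfold ball; simpl; unfold AbsRing_ball, abs, minus, plus, opp; simpl.
rewrite Ropp_0, Rplus_0_r; intros Ht; apply HP.
assert (K := H t); assert (Z := Rle_abs (g t)); assert (Y := Rmax_Cmod (f t)).
assert (Y1 := Rmax_l (Rabs (fst (f t))) (Rabs (snd (f t)))).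
assert (Y2 := Rmax_r (Rabs (fst (f t))) (Rabs (snd (f t)))).
split; unfold ball; simpl; unfold AbsRing_ball, abs, minus, plus, opp; simpl;
  rewrite Ropp_0, Rplus_0_r; lra.
Qed.

(** The antiderivative [cos^(w + 1) sin^(2 s + 1)] tends to 0 at 0 through the sine, and at [PI / 2]
    because [Re w + 1 > 0]. Writing [cos^(w + 2)] as [(1 - sin ^ 2) cos^w] turns this one relation
    into both recurrences. *)
Lemma is_CInt_reduction (w : C) (s : nat) : -1 < Re w ->
  is_CInt (fun t => (2 * INR s + 1)%R * (cospow (w + 2) t * (sin t ^ (2 * s))%R)
     - (w + 1) * (cospow w t * (sin t ^ (2 * S s))%R))%C 0 (PI / 2) 0.
Proof.
intros Hw; assert (Hpi := PI_RGT_0).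
replace (RtoC 0) with (@minus C_R_NormedModule (RtoC 0) (RtoC 0))
  by exact (@minus_zero_r C_R_NormedModule (RtoC 0)).
assert (Dom : forall t, 0 < t < PI / 2 -> 0 < cos t)
  by (intros t Ht; apply cos_gt_0; lra).
apply (is_RInt_gen_antiderivative (V := C_R_CompleteNormedModule)
  (fun t => (cospow (w + 1) t * (sin t ^ (2 * s + 1))%R)%C)); [lra| | | |].
- intros t Ht; assert (Hc := Dom t Ht).
  assert (E1 : cospow (w + 1) t = (cos t * cospow w t)%C)
    by now rewrite cospow_plus, cospow_1, Cmult_comm.
  assert (E2 : cospow (w + 2) t = (cos t * (cos t * cospow w t))%C).
  { replace (w + 2)%C with (w + 1 + 1)%C
      by (destruct w; apply injective_projections; simpl; ring).
    now rewrite cospow_plus, E1, cospow_1, Cmult_comm. }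
  assert (D : @is_derive R_AbsRing C_R_NormedModule
    (fun t => (cospow (w + 1) t * (sin t ^ (2 * s + 1))%R)%C) t
    (- (w + 1) * cospow (w + 1) t * (sin t / cos t)%R * (sin t ^ (2 * s + 1))%R
     + cospow (w + 1) t * (INR (2 * s + 1) * cos t * sin t ^ (2 * s))%R)%C).
  (* The exponent is brought into the shape [pred k] that differentiating [sin t ^ k] produces, so
     that [k] can be generalized. *)
  { replace (2 * s)%nat with (Init.Nat.pred (2 * s + 1)) at 3 by lia.
    generalize (2 * s + 1)%nat; intros k.
    apply is_derive_C; unfold cospow, Cexp; destruct w as [x y]; simpl;
      (auto_derive; [now repeat split|unfold Rminus; field; lra]). }
  replace (_ - _)%C with (- (w + 1) * cospow (w + 1) t * (sin t / cos t)%R * (sin t ^ (2 * s + 1))%R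
     + cospow (w + 1) t * (INR (2 * s + 1) * cos t * sin t ^ (2 * s))%R)%C; [exact D|].
  replace (2 * S s)%nat with (S (S (2 * s))) by lia.
  replace (2 * s + 1)%nat with (S (2 * s)) by lia.
  rewrite E2, E1, S_INR, mult_INR.
  destruct w as [x y]; destruct (cospow (x, y) t) as [u v].
  apply injective_projections; simpl; field; lra.
- intros t Ht; assert (Hc := Dom t Ht).
  apply continuous_C; apply (ex_derive_continuous (V := R_NormedModule));
    unfold cospow, Cexp; destruct w; simpl; auto_derive; now repeat split.
- assert (L : @continuous R_UniformSpace C_R_NormedModule
    (fun t => (cospow (w + 1) t * (sin t ^ (2 * s + 1))%R)%C) 0).
  { assert (Hc : 0 < cos 0) by (rewrite cos_0; lra).
    apply continuous_C; apply (ex_derive_continuous (V := R_NormedModule));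
      unfold cospow, Cexp; destruct w; simpl; auto_derive; now repeat split. }
  eapply filterlim_filter_le_1; [apply filter_le_within|].
  unfold continuous in L; rewrite sin_0, pow_i, Cmult_0_r in L by lia; exact L.
(* At [PI / 2] itself [ln] takes its default value 0 and [cospow] is 1; only the left limit
   vanishes. *)
- apply filterlim_C_squeeze with (fun t => exp ((Re w + 1) * ln (cos t)));
    [apply within_filter, locally_filter| |now apply exp_mult_ln_cos_lim; lra].
  intros t; replace (Re w + 1) with (Re (w + 1)) by now destruct w.
  apply Cmod_cospow_sin_le.
Qed.
Definition is_cosint (w : C) (s : nat) (I : C) : Prop :=
  is_CInt (fun t => cospow w t * (sin t ^ (2 * s))%R)%C 0 (PI / 2) I.

(** For [c < 0] the default [ln c = 0] leaves a linear function. At [c = 0], where [ln] is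
    discontinuous, the bracket has modulus at most 1 nearby and the factor [c] forces the limit
    0. *)
Lemma continuous_mult_exp_ln (p q : R) (f : R -> R) (c : R) : 0 <= p ->
  (forall x, continuous f x) -> (forall x, Rabs (f x) <= 1) ->
  continuous (fun c => c * (exp (p * ln c) * f (q * ln c))) c.
Proof.
intros Hp Hf Bf.
destruct (total_order_T c 0) as [[Hc|Hc]|Hc].
- apply (continuous_ext_loc _ (fun c => c * (exp (p * 0) * f (q * 0)))).
  + generalize (open_lt 0 c Hc); apply filter_imp; intros y Hy.
    simpl in Hy; rewrite ln_nonpos by lra; reflexivity.
  + apply (continuous_mult (K := R_AbsRing) (fun c => c)); [apply continuous_id|apply continuous_const].
- subst c; apply filterlim_locally; intros eps.
  rewrite Rmult_0_l.
  assert (L := locally_ball 0 eps).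
  assert (L1 : locally 0 (fun y => y < 1)) by (apply (open_lt 1 0); lra).
  generalize (filter_and _ _ L L1); apply filter_imp; intros y.
  unfold ball; simpl; unfold AbsRing_ball, abs, minus, plus, opp; simpl.
  rewrite Ropp_0, !Rplus_0_r; intros [Hy Hy1].
  rewrite !Rabs_mult, (Rabs_pos_eq (exp _)) by (left; apply exp_pos).
  assert (E : exp (p * ln y) <= 1).
  { rewrite <- exp_0; apply exp_le_exp.
    assert (ln y <= 0) by (apply ln_le_0; lra); nra. }
  assert (E0 := exp_pos (p * ln y)).
  assert (B := Bf (q * ln y)); assert (B0 := Rabs_pos (f (q * ln y))).
  assert (A := Rabs_pos y).
  apply Rle_lt_trans with (Rabs y * 1); [|lra].
  apply Rmult_le_compat_l; trivial; rewrite <- (Rmult_1_r 1).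
  apply Rmult_le_compat; lra.
- assert (L : continuous ln c)
    by (apply (ex_derive_continuous (V := R_NormedModule)); auto_derive; trivial).
  apply (continuous_mult (K := R_AbsRing) (fun c => c)); [apply continuous_id|].
  apply (continuous_mult (K := R_AbsRing) (fun c => exp (p * ln c))).
  + apply (ex_derive_continuous (V := R_NormedModule)); auto_derive; trivial.
  + apply continuous_comp; [|apply Hf].
    apply (continuous_mult (K := R_AbsRing) (fun _ => q)); [apply continuous_const|exact L].
Qed.

(** Writing [cos^w] as [cos * cos^(w - 1)] with a bounded second factor makes the
    integrand continuous on the whole line, so that the integral is proper. *)
Lemma is_cosint_base (w : C) : 1 <= Re w -> exists I, is_cosint w 0 I.
Proof.
intros Hw; assert (Hpi := PI_RGT_0).
set (G := fun t => (cos t * (exp ((Re w - 1) * ln (cos t)) * cos (Im w * ln (cos t))),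
  cos t * (exp ((Re w - 1) * ln (cos t)) * sin (Im w * ln (cos t)))) : C).
exists (@RInt C_R_CompleteNormedModule G 0 (PI / 2)).
unfold is_cosint; apply (is_CInt_ext G); [lra| |].
- intros t Ht; assert (Hc : 0 < cos t) by (apply cos_gt_0; lra).
  assert (E : exp (Re w * ln (cos t)) = cos t * exp ((Re w - 1) * ln (cos t))).
  { rewrite <- (exp_ln (cos t)) at 2 by trivial.
    rewrite <- exp_plus; f_equal; ring. }
  unfold G, cospow, Cexp; destruct w as [x y]; simpl in *.
  rewrite !Rmult_0_r, Rplus_0_l, Rminus_0_r, E.
  apply injective_projections; simpl; ring.
- apply (is_RInt_gen_continuous (V := C_R_CompleteNormedModule)); [lra|].
  intros t; apply continuous_C; unfold G; simpl.
  + apply (continuous_comp cos (fun c => c * (exp ((Re w - 1) * ln c) * cos (Im w * ln c))));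
      [apply continuous_cos|].
    apply continuous_mult_exp_ln; [lra|apply continuous_cos|].
    intros x; apply Rabs_le, COS_bound.
  + apply (continuous_comp cos (fun c => c * (exp ((Re w - 1) * ln c) * sin (Im w * ln c))));
      [apply continuous_cos|].
    apply continuous_mult_exp_ln; [lra|apply continuous_sin|].
    intros x; apply Rabs_le, SIN_bound.
Qed.

Lemma Re_neq_0 (z : C) : 0 < Re z -> z <> RtoC 0.
Proof. intros H E; rewrite E in H; simpl in H; lra. Qed.

Lemma cospow_2 (w : C) (t : R) : 0 < cos t ->
  cospow (w + 2) t = ((1 - sin t ^ 2)%R * cospow w t)%C.
Proof.
intros H; replace (w + 2)%C with (w + RtoC 1 + RtoC 1)%C
  by (destruct w; apply injective_projections; simpl; ring).
rewrite !cospow_plus, cospow_1 by trivial.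
assert (E := sin2_cos2 t); unfold Rsqr in E.
replace (1 - sin t ^ 2) with (cos t * cos t) by (simpl; lra).
rewrite RtoC_mult; ring.
Qed.

(** Going down from [w + 2] to [w] extends existence from [Re w >= 1] to [Re w > -1]: the given
    integral is combined with the vanishing one of [is_CInt_reduction] so that the integrands add up
    to [cos^w]. *)
Lemma is_cosint_shift (w I : C) : -1 < Re w ->
  is_cosint (w + 2) 0 I -> is_cosint w 0 ((w + 2) / (w + 1) * I)%C.
Proof.
intros Hw HI; assert (Hpi := PI_RGT_0).
assert (W1 : (w + 1)%C <> 0) by (apply Re_neq_0; destruct w; simpl in *; lra).
replace ((w + 2) / (w + 1) * I)%C
  with ((w + 2) / (w + 1) * I + (- (1) / (w + 1)) * 0)%C by ring.
assert (K := is_CInt_plus _ _ _ _ _ _ (is_CInt_scal ((w + 2) / (w + 1))%C _ _ _ _ HI)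
  (is_CInt_scal (- (1) / (w + 1))%C _ _ _ _ (is_CInt_reduction w 0 Hw))).
revert K; unfold is_cosint; apply is_CInt_ext; [lra|].
intros t Ht; cbv beta.
rewrite cospow_2 by (apply cos_gt_0; lra).
simpl (2 * _)%nat; simpl INR; simpl pow.
rewrite Rmult_0_r, Rplus_0_l, !Rmult_1_r, RtoC_minus, RtoC_mult; field; trivial.
Qed.

Lemma is_cosint_sin_step (w : C) (s : nat) (I : C) : -1 < Re w ->
  is_cosint w s I ->
  is_cosint w (S s) ((2 * INR s + 1)%R / (w + (2 * INR s + 2)%R) * I)%C.
Proof.
intros Hw HI; assert (Hpi := PI_RGT_0).
assert (W1 : (w + (2 * INR s + 2)%R)%C <> 0)
  by (apply Re_neq_0; destruct w; generalize (pos_INR s); simpl in *; lra).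
set (d := (w + (2 * INR s + 2)%R)%C) in *.
replace ((2 * INR s + 1)%R / d * I)%C
  with ((2 * INR s + 1)%R / d * I + (- (1) / d) * 0)%C by ring.
assert (K := is_CInt_plus _ _ _ _ _ _ (is_CInt_scal ((2 * INR s + 1)%R / d)%C _ _ _ _ HI)
  (is_CInt_scal (- (1) / d)%C _ _ _ _ (is_CInt_reduction w s Hw))).
revert K; unfold is_cosint; apply is_CInt_ext; [lra|].
intros t Ht; cbv beta.
rewrite cospow_2 by (apply cos_gt_0; lra).
replace (2 * S s)%nat with (2 + 2 * s)%nat by lia.
rewrite pow_add, RtoC_mult, RtoC_minus.
(* In terms of [d] the coefficients [2 s + 1] and [w + 1] of [sin^(2 s + 2)] visibly add up to
   [d]. *)
replace (w + 1)%C with (d - (2 * INR s + 1)%R)%C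
  by (unfold d; rewrite !RtoC_plus; ring).
field; trivial.
Qed.

Definition cosint (w : C) (s : nat) : C :=
  @RInt_gen C_R_CompleteNormedModule
    (fun t => (cospow w t * (sin t ^ (2 * s))%R)%C) (at_right 0) (at_left (PI / 2)).

Lemma is_cosint_unique (w : C) (s : nat) (I : C) : is_cosint w s I -> cosint w s = I.
Proof.
exact (@is_RInt_gen_unique C_R_CompleteNormedModule (at_right 0)
  (at_left (PI / 2)) _ _ _ I).
Qed.

Lemma is_cosint_cosint (w : C) (s : nat) : -1 < Re w -> is_cosint w s (cosint w s).
Proof.
intros Hw; enough (exists I, is_cosint w s I) as [I HI]
  by now rewrite (is_cosint_unique _ _ _ HI).
induction s as [|s [I HI]].
- destruct (is_cosint_base (w + 2)) as [I HI]; [destruct w; simpl in *; lra|].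
  exists ((w + 2) / (w + 1) * I)%C; now apply is_cosint_shift.
- eexists; now apply (is_cosint_sin_step w s I).
Qed.

Lemma cosint_shift (w : C) : -1 < Re w ->
  ((w + 1) * cosint w 0)%C = ((w + 2) * cosint (w + 2) 0)%C.
Proof.
intros Hw.
assert (W1 : (w + 1)%C <> 0) by (apply Re_neq_0; destruct w; simpl in *; lra).
rewrite (is_cosint_unique w 0 ((w + 2) / (w + 1) * cosint (w + 2) 0)).
- field; trivial.
- apply is_cosint_shift; trivial.
  apply is_cosint_cosint; destruct w; simpl in *; lra.
Qed.

Lemma cosint_sin_step (w : C) (s : nat) : -1 < Re w ->
  ((w + (2 * INR s + 2)%R) * cosint w (S s))%C = ((2 * INR s + 1)%R * cosint w s)%C.
Proof.
intros Hw.
assert (W1 : (w + (2 * INR s + 2)%R)%C <> 0)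
  by (apply Re_neq_0; destruct w; generalize (pos_INR s); simpl in *; lra).
rewrite (is_cosint_unique w (S s) ((2 * INR s + 1)%R / (w + (2 * INR s + 2)%R) * cosint w s)).
- field; trivial.
- now apply is_cosint_sin_step, is_cosint_cosint.
Qed.

(** * Wallis's formula *)

(** Taking the real part loses nothing, by [cosint_INR]. *)
Definition wallis (n : nat) : R := Re (cosint (INR n) 0).

Lemma INR_gt_m1 (n : nat) : -1 < INR n.
Proof. generalize (pos_INR n); lra. Qed.

Lemma is_RInt_gen_exp_mult_ln_cos (x : R) : -1 < x ->
  is_RInt_gen (fun t => exp (x * ln (cos t))) (at_right 0) (at_left (PI / 2))
    (Re (cosint x 0)).
Proof.
intros Hx; assert (H := is_cosint_cosint x 0 Hx).
unfold is_cosint in H; rewrite is_CInt_components in H; destruct H as [H _].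
revert H; apply (is_RInt_gen_ext_open (V := R_NormedModule));
  [generalize PI_RGT_0; lra|].
intros t _; rewrite cospow_RtoC; simpl; ring.
Qed.

Lemma wallis_spec (n : nat) :
  is_RInt_gen (fun t => exp (INR n * ln (cos t))) (at_right 0) (at_left (PI / 2))
    (wallis n).
Proof. apply is_RInt_gen_exp_mult_ln_cos, INR_gt_m1. Qed.

Lemma cosint_INR (n : nat) : cosint (INR n) 0 = RtoC (wallis n).
Proof.
apply is_cosint_unique; unfold is_cosint; apply (proj2 (is_CInt_components _ _ _ _)); split.
- generalize (wallis_spec n); apply (is_RInt_gen_ext_open (V := R_NormedModule));
    [generalize PI_RGT_0; lra|].
  intros t _; rewrite cospow_RtoC; simpl; ring.
(* The zero imaginary part is integrated as 0 times the convergent real integral. *)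
- assert (Z := is_RInt_gen_scal (V := R_NormedModule) _ 0 _ (wallis_spec n)).
  replace (Im (RtoC (wallis n))) with (@scal R_AbsRing R_NormedModule 0 (wallis n))
    by exact (Rmult_0_l _).
  revert Z; apply (is_RInt_gen_ext_open (V := R_NormedModule)); [generalize PI_RGT_0; lra|].
  intros t _; rewrite cospow_RtoC; unfold scal; simpl; unfold mult; simpl; ring.
Qed.

Lemma wallis_step (n : nat) : (INR n + 2) * wallis (S (S n)) = (INR n + 1) * wallis n.
Proof.
assert (H := cosint_shift (INR n) (INR_gt_m1 n)).
rewrite <- RtoC_plus, <- RtoC_plus in H.
replace (INR n + 2) with (INR (S (S n))) in H by (rewrite !S_INR; ring).
rewrite !cosint_INR, <- !RtoC_mult in H; apply RtoC_inj in H.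
rewrite !S_INR in H at 1; lra.
Qed.

Lemma Cmod_cosint_le (w : C) (s : nat) (J : R) : -1 < Re w ->
  is_RInt_gen (fun t => exp (Re w * ln (cos t))) (at_right 0) (at_left (PI / 2)) J ->
  Cmod (cosint w s) <= J.
Proof.
intros Hw; generalize (is_cosint_cosint w s Hw); unfold is_cosint.
apply is_CInt_norm_le; [generalize PI_RGT_0; lra|].
intros t _; apply Cmod_cospow_sin_le.
Qed.

Lemma wallis_decr (n : nat) : 0 <= wallis (S n) <= wallis n.
Proof.
(* Both inequalities come from norm estimates: [wallis m] dominates a modulus, hence is nonnegative,
   and is then equal to its own modulus. *)
assert (P : forall n, 0 <= wallis n).
{ intros m; apply Rle_trans with (2 := Cmod_cosint_le (INR m) 0 _ (INR_gt_m1 m)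
    (wallis_spec m)); apply Cmod_ge_0. }
split; [apply P|].
rewrite <- (Rabs_pos_eq (wallis (S n))), <- Cmod_R by apply P.
assert (H := is_cosint_cosint (INR (S n)) 0 (INR_gt_m1 (S n))).
rewrite cosint_INR in H; unfold is_cosint in H.
generalize (wallis_spec n); revert H; apply is_CInt_norm_le; [generalize PI_RGT_0; lra|].
intros t _; eapply Rle_trans; [apply Cmod_cospow_sin_le|]; apply exp_le_exp.
change (Re (INR (S n))) with (INR (S n)).
rewrite S_INR; generalize (ln_cos_le_0 t); lra.
Qed.

Lemma wallis_unique (n : nat) (J : R) :
  is_RInt_gen (fun t => exp (INR n * ln (cos t))) (at_right 0) (at_left (PI / 2)) J ->
  wallis n = J.
Proof.
intros H; assert (U := @is_RInt_gen_unique R_CompleteNormedModule (at_right 0)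
  (at_left (PI / 2)) _ _ (fun t => exp (INR n * ln (cos t)))).
now rewrite <- (U _ (wallis_spec n)), <- (U _ H).
Qed.

Lemma wallis_0 : wallis 0 = PI / 2.
Proof.
assert (Hpi := PI_RGT_0).
apply wallis_unique.
replace (PI / 2) with (minus (PI / 2) 0) at 2
  by (unfold minus, plus, opp; simpl; ring).
apply (is_RInt_gen_antiderivative (V := R_CompleteNormedModule) (fun t => t)); [lra| | | |].
- intros t _; simpl; rewrite Rmult_0_l, exp_0; exact (is_derive_id (K := R_AbsRing) t).
- intros t _; simpl. apply continuous_ext with (fun _ => 1);
    [intros u; now rewrite Rmult_0_l, exp_0|apply continuous_const].
- apply (filterlim_filter_le_1 _ (filter_le_within _)), filterlim_id.
- apply (filterlim_filter_le_1 _ (filter_le_within _)), filterlim_id.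
Qed.

Lemma wallis_1 : wallis 1 = 1.
Proof.
assert (Hpi := PI_RGT_0).
apply wallis_unique.
apply (is_RInt_gen_ext_open cos); [lra| |].
{ intros t Ht; simpl; rewrite Rmult_1_l, exp_ln; trivial; apply cos_gt_0; lra. }
replace 1 with (minus (sin (PI / 2)) (sin 0))
  by (unfold minus, plus, opp; simpl; rewrite sin_PI2, sin_0; ring).
apply (is_RInt_gen_antiderivative (V := R_CompleteNormedModule) sin); [lra| | | |].
- intros t _; apply is_derive_Reals, derivable_pt_lim_sin.
- intros t _; apply continuous_cos.
- apply (filterlim_filter_le_1 _ (filter_le_within _)), (continuous_sin 0).
- apply (filterlim_filter_le_1 _ (filter_le_within _)), (continuous_sin (PI / 2)).
Qed.

(** By [wallis_step] the left side does not depend on [n]. *)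
Lemma wallis_prod (n : nat) : (INR n + 1) * (wallis n * wallis (S n)) = PI / 2.
Proof.
induction n as [|n IH]; [rewrite wallis_0, wallis_1; simpl; ring|].
rewrite <- IH, S_INR.
transitivity (wallis (S n) * ((INR n + 2) * wallis (S (S n)))); [ring|].
rewrite wallis_step; ring.
Qed.

(** By monotonicity the square of [W_(2n+2)] lies between its products with [W_(2n+3)] and with
    [W_(2n+1)]. By [wallis_prod] these are [(PI / 2) / (2 n + 3)] and [(PI / 2) / (2 n + 2)], so [n]
    times the square tends to [PI / 4]. *)
Lemma wallis_lim : is_lim_seq (fun n => sqrt (INR n) * wallis (2 * n + 2)) (sqrt PI / 2).
Proof.
assert (Hpi := PI_RGT_0).
replace (sqrt PI / 2) with (sqrt (PI / 4)).
2: { unfold Rdiv at 1; rewrite sqrt_mult_alt by lra.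
  replace (/ 4) with ((/ 2) * (/ 2)) by field; rewrite sqrt_square; lra. }
apply is_lim_seq_ext with (fun n => sqrt (INR n * wallis (2 * n + 2) ^ 2)).
{ intros n; rewrite sqrt_mult_alt by apply pos_INR; rewrite sqrt_pow2; trivial.
  replace (2 * n + 2)%nat with (S (2 * n + 1)) by lia; apply wallis_decr. }
apply is_lim_seq_continuous; [apply continuity_pt_sqrt; lra|].
assert (Lim : forall c : R, is_lim_seq (fun n => PI / 2 * / (2 + c * / INR n)) (PI / 4)).
{ intros c; replace (PI / 4) with (PI / 2 * / (2 + c * 0)) by field.
  apply (is_lim_seq_scal_l _ _ (/ (2 + c * 0))).
  apply (is_lim_seq_inv _ (2 + c * 0)); [|intros E; injection E; lra].
  apply is_lim_seq_plus'; [apply is_lim_seq_const|].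
  apply (is_lim_seq_scal_l _ _ 0).
  apply (is_lim_seq_inv _ p_infty); [apply is_lim_seq_INR|easy]. }
apply is_lim_seq_le_le_loc with (2 := Lim 3) (3 := Lim 2).
exists 1%nat; intros n Hn; apply le_INR in Hn; simpl in Hn.
assert (P := wallis_prod (2 * n + 1)); assert (P' := wallis_prod (2 * n + 2)).
assert (D := wallis_decr (2 * n + 1)); assert (D' := wallis_decr (2 * n + 2)).
replace (S (2 * n + 1))%nat with (2 * n + 2)%nat in * by lia.
rewrite plus_INR, mult_INR in P, P'.
replace (INR 2) with 2 in * by now simpl.
replace (INR 1) with 1 in * by now simpl.
set (W := wallis (2 * n + 2)) in *; set (N := INR n) in *.
split.
- apply Rle_trans with (N * ((PI / 2) / (2 * N + 3))); [right; field; lra|].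
  apply Rmult_le_compat_l; [lra|].
  rewrite <- P'; replace (2 * N + 2 + 1) with (2 * N + 3) by ring.
  replace (_ / _) with (W * wallis (S (2 * n + 2))) by (field; lra); nra.
- apply Rle_trans with (N * ((PI / 2) / (2 * N + 2))); [|right; field; lra].
  apply Rmult_le_compat_l; [lra|].
  rewrite <- P; replace (2 * N + 1 + 1) with (2 * N + 2) by ring.
  replace (_ / _) with (wallis (2 * n + 1) * W) by (field; lra); nra.
Qed.
(** * Estimates for the exponential *)

(** Each real estimate below is one application; the second-order ones use a first-order estimate to
    bound the derivative. *)
Lemma Rabs_sub_le_MVT (f df : R -> R) (x M : R) :
  (forall c, is_derive f c (df c)) -> (forall c, Rabs c <= Rabs x -> Rabs (df c) <= M) ->
  Rabs (f x - f 0) <= M * Rabs x.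
Proof.
intros Hf HM.
destruct (MVT_cor4 f df 0 (Rabs x) (fun c _ => Hf c) x) as [c [E Hc]];
  [rewrite Rminus_0_r; lra|].
rewrite !Rminus_0_r in *; rewrite E, Rabs_mult.
apply Rmult_le_compat_r; [apply Rabs_pos|now apply HM].
Qed.

Lemma Rabs_exp_m1_le (x : R) : Rabs (exp x - 1) <= exp (Rabs x) * Rabs x.
Proof.
rewrite <- exp_0; apply (Rabs_sub_le_MVT exp exp).
- intros c; apply is_derive_Reals, derivable_pt_lim_exp.
- intros c Hc; rewrite Rabs_pos_eq by (left; apply exp_pos).
  apply exp_le_exp; generalize (Rle_abs c); lra.
Qed.

Lemma Rabs_sin_le (y : R) : Rabs (sin y) <= Rabs y.
Proof.
replace (sin y) with (sin y - sin 0) by (rewrite sin_0; ring).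
rewrite <- (Rmult_1_l (Rabs y)); apply (Rabs_sub_le_MVT sin cos).
- intros c; apply is_derive_Reals, derivable_pt_lim_sin.
- intros c _; apply Rabs_le, COS_bound.
Qed.

(** [M = 1] gives the linear bound and [M = Rabs y] the quadratic one; both are used. *)
Lemma Rabs_cos_m1_le (y M : R) : (forall c, Rabs c <= Rabs y -> Rabs (sin c) <= M) ->
  Rabs (cos y - 1) <= M * Rabs y.
Proof.
intros HM; rewrite <- cos_0; apply (Rabs_sub_le_MVT cos (fun x => - sin x)).
- intros c; apply is_derive_Reals, derivable_pt_lim_cos.
- intros c Hc; rewrite Rabs_Ropp; auto.
Qed.

Lemma Rabs_exp_m1_mx_le (x : R) : Rabs (exp x - 1 - x) <= exp (Rabs x) * Rabs x * Rabs x.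
Proof.
replace (exp x - 1 - x) with ((exp x - x) - (exp 0 - 0)) by (rewrite exp_0; ring).
apply (Rabs_sub_le_MVT (fun x => exp x - x) (fun x => exp x - 1)).
- intros c; auto_derive; trivial; ring.
- intros c Hc; eapply Rle_trans; [apply Rabs_exp_m1_le|].
  apply Rmult_le_compat; trivial; [left; apply exp_pos|apply Rabs_pos|now apply exp_le_exp].
Qed.

Lemma Rabs_sin_mx_le (y : R) : Rabs (sin y - y) <= Rabs y * Rabs y.
Proof.
replace (sin y - y) with ((sin y - y) - (sin 0 - 0)) by (rewrite sin_0; ring).
apply (Rabs_sub_le_MVT (fun x => sin x - x) (fun x => cos x - 1)).
- intros c; auto_derive; trivial; ring.
- intros c Hc; apply Rle_trans with (2 := Hc).
  rewrite <- (Rmult_1_l (Rabs c)); apply Rabs_cos_m1_le.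
  intros d _; apply Rabs_le, SIN_bound.
Qed.

Lemma Rabs_Im_le_Cmod (z : C) : Rabs (Im z) <= Cmod z.
Proof. eapply Rle_trans; [apply Rmax_r|apply Rmax_Cmod]. Qed.

Lemma Cmod_le_Rabs (z : C) : Cmod z <= Rabs (Re z) + Rabs (Im z).
Proof.
destruct z as [x y]; simpl.
replace (x, y) with (RtoC x + Ci * RtoC y)%C
  by (apply injective_projections; simpl; ring).
eapply Rle_trans; [apply Cmod_triangle|].
rewrite Cmod_mult, Cmod_Ci, !Cmod_R; lra.
Qed.

(** The constant counts the pieces [exp x - 1], [exp x (cos y - 1)] and [exp x sin y], each at most
    [exp r * r] in size. *)
Lemma Cmod_Cexp_m1_le (z : C) : Cmod (Cexp z - 1) <= 3 * (exp (Cmod z) * Cmod z).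
Proof.
eapply Rle_trans; [apply Cmod_le_Rabs|].
assert (Hx := re_le_Cmod z); assert (Hy := Rabs_Im_le_Cmod z).
set (r := Cmod z) in *.
destruct z as [x y]; simpl in *.
replace (exp x * cos y + - (1)) with ((exp x - 1) + exp x * (cos y - 1)) by ring.
replace (exp x * sin y + - 0) with (exp x * sin y) by ring.
assert (E : exp x <= exp r) by (apply exp_le_exp; generalize (Rle_abs x); lra).
assert (E0 := exp_pos x).
assert (A1 : Rabs (exp x - 1) <= exp r * r).
{ eapply Rle_trans; [apply Rabs_exp_m1_le|]; apply Rmult_le_compat; trivial;
    [left; apply exp_pos|apply Rabs_pos|now apply exp_le_exp]. }
assert (A2 : Rabs (exp x * (cos y - 1)) <= exp r * r).
{ rewrite Rabs_mult, Rabs_pos_eq by lra; apply Rmult_le_compat; trivial;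
    [lra|apply Rabs_pos|].
  apply Rle_trans with (2 := Hy); rewrite <- (Rmult_1_l (Rabs y)).
  apply Rabs_cos_m1_le; intros c _; apply Rabs_le, SIN_bound. }
assert (A3 : Rabs (exp x * sin y) <= exp r * r).
{ rewrite Rabs_mult, Rabs_pos_eq by lra; apply Rmult_le_compat; trivial;
    [lra|apply Rabs_pos|]; eapply Rle_trans; [apply Rabs_sin_le|exact Hy]. }
assert (T := Rabs_triang (exp x - 1) (exp x * (cos y - 1))); lra.
Qed.

(** Four pieces of second order: [exp x - 1 - x] and [exp x (cos y - 1)] in the real part,
    [exp x (sin y - y)] and [(exp x - 1) y] in the imaginary part. *)
Lemma Cmod_Cexp_m1_mz_le (z : C) :
  Cmod (Cexp z - 1 - z) <= 4 * (exp (Cmod z) * (Cmod z * Cmod z)).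
Proof.
eapply Rle_trans; [apply Cmod_le_Rabs|].
assert (Hx := re_le_Cmod z); assert (Hy := Rabs_Im_le_Cmod z).
set (r := Cmod z) in *.
destruct z as [x y]; simpl in *.
replace (exp x * cos y + - (1) + - x) with ((exp x - 1 - x) + exp x * (cos y - 1)) by ring.
replace (exp x * sin y + - 0 + - y) with (exp x * (sin y - y) + (exp x - 1) * y) by ring.
assert (E : exp x <= exp r) by (apply exp_le_exp; generalize (Rle_abs x); lra).
assert (Er : exp (Rabs x) <= exp r) by now apply exp_le_exp.
assert (E0 := exp_pos x); assert (E0' := exp_pos (Rabs x)).
assert (Px := Rabs_pos x); assert (Py := Rabs_pos y).
assert (A1 : Rabs (exp x - 1 - x) <= exp r * (r * r)).
{ eapply Rle_trans; [apply Rabs_exp_m1_mx_le|]; rewrite Rmult_assoc.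
  apply Rmult_le_compat; try lra; [nra|apply Rmult_le_compat; lra]. }
assert (A2 : Rabs (exp x * (cos y - 1)) <= exp r * (r * r)).
{ rewrite Rabs_mult, (Rabs_pos_eq (exp x)) by lra.
  apply Rmult_le_compat; trivial; [lra|apply Rabs_pos|].
  apply Rle_trans with (Rabs y * Rabs y); [|apply Rmult_le_compat; lra].
  apply Rabs_cos_m1_le; intros c Hc; eapply Rle_trans; [apply Rabs_sin_le|exact Hc]. }
assert (A3 : Rabs (exp x * (sin y - y)) <= exp r * (r * r)).
{ rewrite Rabs_mult, (Rabs_pos_eq (exp x)) by lra.
  apply Rmult_le_compat; trivial; [lra|apply Rabs_pos|].
  eapply Rle_trans; [apply Rabs_sin_mx_le|apply Rmult_le_compat; lra]. }
assert (A4 : Rabs ((exp x - 1) * y) <= exp r * (r * r)).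
{ rewrite Rabs_mult, <- Rmult_assoc; apply Rmult_le_compat; trivial; [apply Rabs_pos|].
  eapply Rle_trans; [apply Rabs_exp_m1_le|apply Rmult_le_compat; lra]. }
assert (T := Rabs_triang (exp x - 1 - x) (exp x * (cos y - 1))).
assert (T' := Rabs_triang (exp x * (sin y - y)) ((exp x - 1) * y)); lra.
Qed.

(** * The limit of [sqrt n * I (w + 2 n + 2)] *)

Definition Cis_lim (u : nat -> C) (l : C) : Prop :=
  is_lim_seq (fun n => Re (u n)) (Re l) /\ is_lim_seq (fun n => Im (u n)) (Im l).

Lemma Cis_lim_unique (u : nat -> C) (l : C) : Cis_lim u l -> CLim_seq u = l.
Proof.
intros [H1 H2]; unfold CLim_seq.
rewrite (is_lim_seq_unique _ _ H1), (is_lim_seq_unique _ _ H2); now destruct l.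
Qed.

Lemma Cis_lim_const (c : C) : Cis_lim (fun _ => c) c.
Proof. split; apply is_lim_seq_const. Qed.

Lemma Cis_lim_RtoC (u : nat -> R) (l : R) : is_lim_seq u l -> Cis_lim (fun n => RtoC (u n)) (RtoC l).
Proof. intros H; split; [exact H|apply is_lim_seq_const]. Qed.

Lemma Cis_lim_ext_loc (u v : nat -> C) (l : C) :
  eventually (fun n => u n = v n) -> Cis_lim u l -> Cis_lim v l.
Proof.
intros E [H1 H2]; split; [revert H1|revert H2]; apply is_lim_seq_ext_loc;
  revert E; apply filter_imp; now intros n ->.
Qed.

Lemma Cis_lim_plus (u v : nat -> C) (l m : C) :
  Cis_lim u l -> Cis_lim v m -> Cis_lim (fun n => u n + v n)%C (l + m)%C.
Proof. intros [H1 H2] [K1 K2]; split; apply is_lim_seq_plus'; trivial. Qed.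

Lemma Cis_lim_mult (u v : nat -> C) (l m : C) :
  Cis_lim u l -> Cis_lim v m -> Cis_lim (fun n => u n * v n)%C (l * m)%C.
Proof.
intros [H1 H2] [K1 K2]; split; simpl.
- apply is_lim_seq_minus'; apply is_lim_seq_mult'; trivial.
- apply is_lim_seq_plus'; apply is_lim_seq_mult'; trivial.
Qed.

Lemma Cis_lim_0 (u : nat -> C) (e : nat -> R) :
  eventually (fun n => Cmod (u n) <= e n) -> is_lim_seq e 0 -> Cis_lim u 0.
Proof.
intros H He.
assert (He' : is_lim_seq (fun n => - e n) 0).
{ rewrite <- Ropp_0; apply (is_lim_seq_opp e 0); trivial. }
split; apply is_lim_seq_le_le_loc with (2 := He') (3 := He);
  revert H; apply filter_imp; intros n Hn; apply Rabs_le_between.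
- eapply Rle_trans; [apply re_le_Cmod|exact Hn].
- eapply Rle_trans; [apply Rabs_Im_le_Cmod|exact Hn].
Qed.

Lemma is_lim_seq_inv_sqrt_INR : is_lim_seq (fun n => / sqrt (INR n)) 0.
Proof.
apply (is_lim_seq_inv _ p_infty); [|easy].
apply (filterlim_comp _ _ _ INR sqrt _ (Rbar_locally p_infty)).
- apply is_lim_seq_INR.
- apply filterlim_sqrt_p.
Qed.

(** Since [cos t <= 1], [|cos t ^ w - 1|] is at most a constant times
    [cos t ^ - N * (cos t ^ - 2 - 1)] as soon as [|w| <= N]. *)
Lemma cosint_near_wallis (w : C) (N k : nat) : Cmod w <= INR N -> -1 < Re w ->
  Cmod (cosint (w + INR (k + (N + 2))) 0 - wallis (k + (N + 2)))
    <= 3 / 2 * INR N * (wallis k - wallis (S (S k))).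
Proof.
intros HN Hw; set (m := (k + (N + 2))%nat).
assert (H1 : is_cosint (w + INR m) 0 (cosint (w + INR m) 0)).
{ apply is_cosint_cosint; generalize (pos_INR m); destruct w; simpl in *; lra. }
assert (H2 := is_cosint_cosint (INR m) 0 (INR_gt_m1 m)).
rewrite cosint_INR in H2; unfold is_cosint in H1, H2.
assert (H := is_CInt_plus _ _ _ _ _ _ H1 (is_CInt_scal (- (1))%C _ _ _ _ H2)).
replace (cosint (w + INR m) 0 - wallis m)%C
  with (cosint (w + INR m) 0 + - (1) * wallis m)%C by ring.
assert (K := is_RInt_gen_scal (V := R_NormedModule) _ (3 / 2 * INR N) _
  (is_RInt_gen_minus (V := R_NormedModule) _ _ _ _ (wallis_spec k) (wallis_spec (S (S k))))).
generalize K; revert H; apply is_CInt_norm_le; [generalize PI_RGT_0; lra|].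
intros t _; change (sin t ^ (2 * 0)) with 1.
rewrite cospow_plus.
replace (_ + _)%C with (cospow (INR m) t * (cospow w t - 1))%C by ring.
rewrite Cmod_mult, Cmod_cospow; unfold cospow at 1.
change (Re (RtoC (INR m))) with (INR m).
assert (L0 := ln_cos_le_0 t); set (L := ln (cos t)) in *.
assert (B := Cmod_Cexp_m1_le (w * L)).
rewrite Cmod_mult, Cmod_R, Rabs_left1 in B by trivial.
(* The bound [- L <= (exp (- 2 L) - 1) / 2] trades the logarithm for powers of [cos]. Multiplied by
   [cos^m] with [m = k + N + 2], they become [cos^k - cos^(k + 2)]; the constant [3 / 2] joins this
   half to the 3 of [Cmod_Cexp_m1_le]. *)
assert (B1 : exp (Cmod w * - L) * (Cmod w * - L) <= exp (INR N * - L) * (INR N * ((exp (- (2 * L)) - 1) / 2))).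
{ assert (Hw0 := Cmod_ge_0 w).
  apply Rmult_le_compat; [left; apply exp_pos|nra|apply exp_le_exp; nra|].
  apply Rmult_le_compat; try lra.
  assert (X := exp_ineq1_le (- (2 * L))); lra. }
apply Rle_trans with (exp (INR m * L) * (3 * (exp (INR N * - L) * (INR N * ((exp (- (2 * L)) - 1) / 2))))).
{ apply Rmult_le_compat_l; [left; apply exp_pos|lra]. }
right; change (exp (INR m * L) *
  (3 * (exp (INR N * - L) * (INR N * ((exp (- (2 * L)) - 1) / 2)))) =
  3 / 2 * INR N * (exp (INR k * L) - exp (INR (S (S k)) * L))).
replace (INR m * L) with (INR (S (S k)) * L + INR N * L)
  by (unfold m; rewrite !plus_INR, !S_INR; simpl; ring).
replace (INR k * L) with (INR (S (S k)) * L + - (2 * L))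
  by (rewrite !S_INR; ring).
replace (INR N * - L) with (- (INR N * L)) by ring.
rewrite !exp_plus, (exp_Ropp (INR N * L)).
assert (P := exp_pos (INR N * L)); field; lra.
Qed.

Lemma cosint_lim (w : C) : -1 < Re w ->
  Cis_lim (fun n => sqrt (INR n) * cosint (w + INR (2 * n + 2)) 0)%C (RtoC (sqrt PI / 2)).
Proof.
intros Hw; assert (Hpi := PI_RGT_0).
destruct (INR_unbounded (Cmod w)) as [N HN].
apply Cis_lim_ext_loc with (fun n => sqrt (INR n) * wallis (2 * n + 2) +
  sqrt (INR n) * (cosint (w + INR (2 * n + 2)) 0 - wallis (2 * n + 2)))%C.
{ exists 0%nat; intros n _; ring. }
replace (RtoC (sqrt PI / 2)) with (sqrt PI / 2 + 0)%C by
  (rewrite RtoC_div; [ring|lra]).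
apply Cis_lim_plus.
- apply (Cis_lim_ext_loc (fun n => RtoC (sqrt (INR n) * wallis (2 * n + 2)))).
  { exists 0%nat; intros n _; apply RtoC_mult. }
  rewrite <- RtoC_div by lra.
  apply Cis_lim_RtoC, wallis_lim.
- apply Cis_lim_0 with (fun n => 3 / 2 * INR N * (PI / 2) * / sqrt (INR n)).
  2: { rewrite <- (Rmult_0_r (3 / 2 * INR N * (PI / 2))).
    apply (is_lim_seq_scal_l _ _ 0), is_lim_seq_inv_sqrt_INR. }
  (* Beyond [N] the index [k = 2 n - N] is at least [n], so bounds in [1 / k] become bounds in
     [1 / n]. *)
  exists (S N); intros n Hn.
  replace (2 * n + 2)%nat with ((2 * n - N) + (N + 2))%nat by lia.
  set (k := (2 * n - N)%nat).
  assert (Hk : INR n <= INR k + 2).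
  { apply Rle_trans with (INR k); [apply le_INR; unfold k; lia|lra]. }
  assert (Hn1 : 1 <= INR n) by (apply (le_INR 1); lia).
  rewrite Cmod_mult, Cmod_R, Rabs_pos_eq by apply sqrt_pos.
  assert (B := cosint_near_wallis w N k (Rlt_le _ _ HN) Hw).
  assert (St := wallis_step k).
  assert (W : wallis k <= PI / 2).
  { clear; rewrite <- wallis_0; induction k as [|k IH]; [lra|].
    apply Rle_trans with (2 := IH), wallis_decr. }
  (* By [wallis_step] the difference equals [wallis k / (k + 2)]; after multiplication by [sqrt n]
     it is still [O(1 / sqrt n)]. *)
  assert (D : wallis k - wallis (S (S k)) <= PI / 2 * / INR n).
  { apply Rle_trans with (wallis k * / (INR k + 2)).
    - right; apply (Rmult_eq_reg_l (INR k + 2)); [|lra].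
      rewrite Rmult_minus_distr_l, St; field; lra.
    - apply Rmult_le_compat; [|left; apply Rinv_0_lt_compat; lra|exact W|].
      + apply Rle_trans with (1 := proj1 (wallis_decr k)), wallis_decr.
      + apply Rinv_le_contravar; lra. }
  assert (Hs : 0 < sqrt (INR n)) by (apply sqrt_lt_R0; lra).
  apply Rle_trans with (sqrt (INR n) * (3 / 2 * INR N * (PI / 2 * / INR n))).
  + apply Rmult_le_compat_l; [lra|]; apply Rle_trans with (1 := B).
    apply Rmult_le_compat_l; [|exact D].
    generalize (pos_INR N); lra.
  + right; rewrite <- (sqrt_sqrt (INR n)) at 2 by lra; field; lra.
Qed.
(** * Gauss's product *)

(** Both [v] and [u + v] decrease, and they are bounded below because [u - v] increases and
    [v >= 0]. Hence both converge, and so does their difference [u]. *)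
Lemma ex_finite_lim_seq_telescoping (u v : nat -> R) :
  (forall n, Rabs (u (S n) - u n) <= v n - v (S n)) -> (forall n, 0 <= v n) ->
  ex_finite_lim_seq u.
Proof.
intros H Hv.
assert (H' : forall n, - (v n - v (S n)) <= u (S n) - u n <= v n - v (S n))
  by (intros n; apply Rabs_le_between, H).
destruct (ex_finite_lim_seq_decr v 0) as [l Hl]; trivial.
{ intros n; generalize (H' n); lra. }
destruct (ex_finite_lim_seq_decr (fun n => u n + v n) (u 0%nat - v 0%nat)) as [m Hm].
- intros n; generalize (H' n); lra.
- assert (B : forall n, u 0%nat - v 0%nat <= u n - v n).
  { induction n as [|n IH]; [lra|]; generalize (H' n); lra. }
  intros n; generalize (B n) (Hv n); lra.
- exists (m - l); apply is_lim_seq_ext with (fun n => (u n + v n) - v n);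
    [intros n; ring|now apply is_lim_seq_minus'].
Qed.

(** By [1 + x <= exp x] the relative increments telescope in an exponent, which bounds [a]; the
    absolute increments then telescope too. Stating the hypothesis without quotients admits
    vanishing terms, which occur in Gauss's product at the poles of Gamma. *)
Lemma Cis_lim_telescoping_prod (a : nat -> C) (K : R) : 0 <= K ->
  (forall n, Cmod (a (S n) - a n) <= Cmod (a n) * (K / INR (S n) - K / INR (S (S n)))) ->
  exists l, Cis_lim a l.
Proof.
intros HK Ha.
assert (Hp : forall n, 0 < INR (S n)) by (intros n; apply lt_0_INR; lia).
set (v := fun n => K / INR (S n)).
assert (Pv : forall n, 0 <= v n)
  by (intros n; unfold v; apply Rmult_le_pos; [lra|left; apply Rinv_0_lt_compat, Hp]).
assert (B : forall n, Cmod (a n) <= Cmod (a 0%nat) * exp (v 0%nat - v n)).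
{ induction n as [|n IH]; [rewrite Rminus_diag, exp_0; lra|].
  replace (a (S n)) with (a n + (a (S n) - a n))%C by ring.
  eapply Rle_trans; [apply Cmod_triangle|].
  apply Rle_trans with (Cmod (a n) * exp (v n - v (S n))).
  - assert (X := exp_ineq1_le (v n - v (S n))).
    assert (Y := Ha n); change (K / INR (S n) - K / INR (S (S n))) with (v n - v (S n)) in Y.
    generalize (Cmod_ge_0 (a n)); nra.
  - replace (v 0%nat - v (S n)) with ((v 0%nat - v n) + (v n - v (S n))) by ring.
    rewrite exp_plus, <- Rmult_assoc; apply Rmult_le_compat_r; trivial.
    left; apply exp_pos. }
set (M := Cmod (a 0%nat) * exp (v 0%nat)).
assert (BM : forall n, Cmod (a n) <= M).
{ intros n; apply Rle_trans with (1 := B n); apply Rmult_le_compat_l; [apply Cmod_ge_0|].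
  apply exp_le_exp; generalize (Pv n); lra. }
assert (PM : 0 <= M) by (apply Rle_trans with (2 := BM 0%nat); apply Cmod_ge_0).
assert (Hd : forall n, Cmod (a (S n) - a n) <= M * v n - M * v (S n)).
{ intros n; apply Rle_trans with (1 := Ha n); rewrite <- Rmult_minus_distr_l.
  apply Rmult_le_compat_r; [|apply BM].
  assert (Z : / INR (S (S n)) <= / INR (S n))
    by (apply Rinv_le_contravar; [apply Hp|apply le_INR; lia]).
  unfold v, Rdiv; generalize (Rmult_le_compat_l K _ _ HK Z); lra. }
assert (PMv : forall n, 0 <= M * v n) by (intros n; apply Rmult_le_pos; auto).
destruct (ex_finite_lim_seq_telescoping (fun n => Re (a n)) (fun n => M * v n)) as [x Hx]; trivial.
{ intros n; apply Rle_trans with (2 := Hd n).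
  change (Re (a (S n)) - Re (a n)) with (Re (a (S n) - a n)); apply re_le_Cmod. }
destruct (ex_finite_lim_seq_telescoping (fun n => Im (a n)) (fun n => M * v n)) as [y Hy]; trivial.
{ intros n; apply Rle_trans with (2 := Hd n).
  change (Im (a (S n)) - Im (a n)) with (Im (a (S n) - a n)); apply Rabs_Im_le_Cmod. }
now exists (x, y).
Qed.

Definition gauss (w : C) (n : nat) : C :=
  (Crising w (S n) / (INR (fact n) * Cexp (w * ln (INR n))))%C.

Lemma RtoC_neq_0 (x : R) : x <> 0 -> RtoC x <> RtoC 0.
Proof. intros H E; now apply H, RtoC_inj. Qed.

Lemma Cexp_neq_0 (z : C) : Cexp z <> RtoC 0.
Proof.
intros E; assert (H := Cmod_Cexp z); rewrite E, Cmod_0 in H.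
generalize (exp_pos (Re z)); lra.
Qed.

Lemma RtoC_fact_neq_0 (n : nat) : RtoC (INR (fact n)) <> RtoC 0.
Proof. apply RtoC_neq_0, INR_fact_neq_0. Qed.

Lemma RtoC_INR_S_neq_0 (n : nat) : RtoC (INR (S n)) <> RtoC 0.
Proof. apply RtoC_neq_0, not_0_INR; lia. Qed.

Lemma Cmult_eq_reg_l (c z w : C) : c <> RtoC 0 -> (c * z = c * w)%C -> z = w.
Proof.
intros Hc E; apply (f_equal (Cmult (/ c))) in E.
now rewrite !Cmult_assoc, Cinv_l, !Cmult_1_l in E.
Qed.

Lemma Cexp_minus (z w : C) : Cexp (z - w) = (Cexp z / Cexp w)%C.
Proof.
replace (Cexp z) with (Cexp (z - w) * Cexp w)%C
  by (rewrite <- Cexp_plus; apply f_equal; ring).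
field; apply Cexp_neq_0.
Qed.

Lemma gauss_S (w : C) (n : nat) :
  gauss w (S n) =
  (gauss w n * ((1 + w * (/ INR (S n))%R) *
     Cexp (- (w * (ln (INR (S n)) - ln (INR n))%R))))%C.
Proof.
unfold gauss.
replace (- (w * (ln (INR (S n)) - ln (INR n))%R))%C
  with (w * ln (INR n) - w * ln (INR (S n)))%C by (rewrite RtoC_minus; ring).
rewrite Cexp_minus.
change (Crising w (S (S n))) with (Crising w (S n) * (w + INR (S n)))%C.
replace (INR (fact (S n))) with (INR (S n) * INR (fact n))
  by (rewrite <- mult_INR; apply f_equal; simpl; ring).
rewrite RtoC_mult, RtoC_inv by (apply not_0_INR; lia).
field; repeat split; auto using Cexp_neq_0, RtoC_fact_neq_0, RtoC_INR_S_neq_0.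
Qed.

(** Both factors are [1 +- w / n] up to [O(1 / n ^ 2)]. *)
Lemma gauss_ratio_bound (w : C) : exists K, 0 <= K /\ forall n,
  Cmod ((1 + w * (/ INR (S (S n)))%R) *
     Cexp (- (w * (ln (INR (S (S n))) - ln (INR (S n)))%R)) - 1)
  <= K / INR (S n) - K / INR (S (S n)).
Proof.
set (r := Cmod w); assert (Hr : 0 <= r) by apply Cmod_ge_0.
(* With [h], [d] and [E] as below, the expression is [w (h - d) - w ^ 2 h d + (1 + w h) E]; the
   three summands of [A] bound these terms, up to the factor [1 / N ^ 2]. *)
set (A := r + r * r + (1 + r) * (4 * (exp r * (r * r)))).
assert (E0 := exp_pos r).
assert (PA : 0 <= A) by (unfold A; assert (0 <= exp r * (r * r)) by nra; nra).
(* The 2 comes from [1 / N ^ 2 <= 2 (1 / N - 1 / (N + 1))]. *)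
exists (2 * A); split; [lra|intros n].
set (N := INR (S n)).
assert (HN : 1 <= N) by (apply (le_INR 1); lia).
replace (INR (S (S n))) with (N + 1) by (unfold N; now rewrite (S_INR (S n))).
set (h := / (N + 1)); set (d := ln (N + 1) - ln N).
assert (Hh : 0 < h) by (apply Rinv_0_lt_compat; lra).
assert (HiN : 0 < / N) by (apply Rinv_0_lt_compat; lra).
assert (HN1 : / N <= 1) by (rewrite <- Rinv_1; apply Rinv_le_contravar; lra).
assert (HhN : h <= / N) by (apply Rinv_le_contravar; lra).
(* Both bounds [h <= d <= 1 / N] are instances of [1 + x <= exp x]. *)
assert (Hd1 : d <= / N).
{ unfold d; rewrite <- ln_div by lra.
  rewrite <- (ln_exp (/ N)); apply ln_le; [apply Rdiv_lt_0_compat; lra|].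
  replace ((N + 1) / N) with (1 + / N) by (field; lra); apply exp_ineq1_le. }
assert (Hd2 : h <= d).
{ assert (X : - d <= - h); [|lra].
  unfold d; rewrite Ropp_minus_distr, <- ln_div by lra.
  rewrite <- (ln_exp (- h)); apply ln_le; [apply Rdiv_lt_0_compat; lra|].
  replace (N / (N + 1)) with (1 + - h) by (unfold h; field; lra); apply exp_ineq1_le. }
assert (Hhd : / N - h = / N * h) by (unfold h; field; lra).
assert (Q : / N * / N <= 2 * (/ N - h)).
{ assert (h >= / N * / 2); [|nra].
  unfold h; rewrite <- Rinv_mult; apply Rle_ge, Rinv_le_contravar; lra. }
set (E := (Cexp (- (w * d)) - 1 - - (w * d))%C).
assert (HE : Cmod E <= 4 * (exp r * (r * r)) * (/ N * / N)).
{ unfold E; eapply Rle_trans; [apply Cmod_Cexp_m1_mz_le|].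
  rewrite Cmod_opp, Cmod_mult, Cmod_R, Rabs_pos_eq by lra; fold r.
  replace (4 * (exp r * (r * r)) * (/ N * / N)) with (4 * (exp r * ((r * / N) * (r * / N)))) by ring.
  assert (D : r * d <= r * / N) by (apply Rmult_le_compat_l; lra).
  assert (D0 : 0 <= r * d) by (apply Rmult_le_pos; lra).
  apply Rmult_le_compat_l; [lra|].
  apply Rmult_le_compat; [left; apply exp_pos|nra| |nra].
  apply exp_le_exp; nra. }
replace (_ - 1)%C with (w * (h - d)%R + (- (w * w * (h * d)%R) + (1 + w * h) * E))%C
  by (unfold E; rewrite RtoC_minus, RtoC_mult; ring).
apply Rle_trans with (A * (/ N * / N)).
- eapply Rle_trans; [apply Cmod_triangle|].
  assert (T := Cmod_triangle (- (w * w * (h * d)%R)) ((1 + w * h) * E)).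
  rewrite Cmod_opp, !Cmod_mult, !Cmod_R in T; fold r in T.
  rewrite Cmod_mult, Cmod_R, Rabs_left1 by lra; fold r.
  rewrite Rabs_pos_eq in T by nra.
  assert (T1 : Cmod (1 + w * h) <= 1 + r).
  { eapply Rle_trans; [apply Cmod_triangle|].
    rewrite Cmod_1, Cmod_mult, Cmod_R, Rabs_pos_eq by lra; fold r; nra. }
  assert (T2 : Cmod (1 + w * h) * Cmod E <= (1 + r) * (4 * (exp r * (r * r)) * (/ N * / N)))
    by (apply Rmult_le_compat; trivial; apply Cmod_ge_0).
  assert (T3 : r * - (h - d) <= r * (/ N * / N)) by (apply Rmult_le_compat_l; nra).
  assert (T4 : r * r * (h * d) <= r * r * (/ N * / N)) by (apply Rmult_le_compat_l; nra).
  unfold A; lra.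
- unfold Rdiv; fold h; nra.
Qed.

(** [Lim_seq] has a value for divergent sequences as well; this is what makes [rGamma] a genuine
    limit. *)
Lemma gauss_lim (w : C) : Cis_lim (gauss w) (rGamma w).
Proof.
enough (exists l, Cis_lim (gauss w) l) as [l Hl].
{ replace (rGamma w) with l; trivial; symmetry; now apply Cis_lim_unique. }
destruct (gauss_ratio_bound w) as [K [HK HB]].
(* The sequence starts at index 1, since at 0 the logarithm is a default value. *)
destruct (Cis_lim_telescoping_prod (fun n => gauss w (S n)) K HK) as [l [H1 H2]].
- intros n; rewrite gauss_S.
  set (q := ((1 + _) * _)%C).
  replace (gauss w (S n) * q - gauss w (S n))%C with (gauss w (S n) * (q - 1))%C by ring.
  rewrite Cmod_mult; apply Rmult_le_compat_l; [apply Cmod_ge_0|apply HB].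
- exists l; split; apply is_lim_seq_incr_1; assumption.
Qed.

Lemma Crising_shift (w : C) (n : nat) :
  (w * Crising (w + 1) n)%C = (Crising w n * (w + INR n))%C.
Proof.
induction n as [|n IH]; [simpl; ring|].
change (Crising (w + 1) (S n)) with (Crising (w + 1) n * (w + 1 + INR n))%C.
rewrite Cmult_assoc, IH, S_INR, RtoC_plus.
change (Crising w (S n)) with (Crising w n * (w + INR n))%C; ring.
Qed.

Lemma is_lim_seq_inv_INR : is_lim_seq (fun n => / INR n) 0.
Proof. apply (is_lim_seq_inv _ p_infty); [apply is_lim_seq_INR|easy]. Qed.

(** [w * gauss (w + 1) n] is [gauss w n] times [(n + w + 1) / n], which tends to 1. *)
Lemma rGamma_rec (w : C) : rGamma w = (w * rGamma (w + 1))%C.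
Proof.
assert (L1 : Cis_lim (fun n => gauss w n * (1 + (w + 1) * (/ INR n)%R))%C (rGamma w)).
{ replace (rGamma w) with (rGamma w * (1 + (w + 1) * RtoC 0))%C by ring.
  apply Cis_lim_mult; [apply gauss_lim|].
  apply Cis_lim_plus; [apply Cis_lim_const|].
  apply Cis_lim_mult; [apply Cis_lim_const|apply Cis_lim_RtoC, is_lim_seq_inv_INR]. }
assert (L2 : Cis_lim (fun n => w * gauss (w + 1) n)%C (w * rGamma (w + 1)))
  by (apply Cis_lim_mult; [apply Cis_lim_const|apply gauss_lim]).
rewrite <- (Cis_lim_unique _ _ L2); symmetry; apply Cis_lim_unique.
revert L1; apply Cis_lim_ext_loc; exists 1%nat; intros n Hn.
assert (Pn : 0 < INR n) by (apply lt_0_INR; lia).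
assert (Nn : RtoC (INR n) <> RtoC 0) by (apply RtoC_neq_0; lra).
unfold gauss.
replace ((w + 1) * ln (INR n))%C with (w * ln (INR n) + ln (INR n))%C by ring.
rewrite Cexp_plus, Cexp_RtoC, exp_ln, RtoC_inv by lra.
replace (w * (Crising (w + 1) (S n) / (INR (fact n) * (Cexp (w * ln (INR n)) * INR n))))%C
  with ((w * Crising (w + 1) (S n)) / (INR (fact n) * (Cexp (w * ln (INR n)) * INR n)))%C
  by (unfold Cdiv; ring).
rewrite Crising_shift, S_INR, RtoC_plus.
field; repeat split; auto using Cexp_neq_0, RtoC_fact_neq_0.
Qed.

Lemma Crising_1 (n : nat) : Crising 1 n = RtoC (INR (fact n)).
Proof.
induction n as [|n IH]; [reflexivity|].
change (Crising 1 (S n)) with (Crising 1 n * (1 + INR n))%C.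
change (fact (S n)) with (S n * fact n)%nat.
rewrite IH, mult_INR, S_INR, RtoC_mult, RtoC_plus; ring.
Qed.

Lemma rGamma_1 : rGamma 1 = RtoC 1.
Proof.
assert (L : Cis_lim (fun n => RtoC (1 + / INR n)) (RtoC (1 + 0))).
{ apply Cis_lim_RtoC, is_lim_seq_plus'; [apply is_lim_seq_const|apply is_lim_seq_inv_INR]. }
rewrite Rplus_0_r in L; apply Cis_lim_unique.
revert L; apply Cis_lim_ext_loc; exists 1%nat; intros n Hn.
assert (Pn : 0 < INR n) by (apply lt_0_INR; lia).
assert (Nn : RtoC (INR n) <> RtoC 0) by (apply RtoC_neq_0; lra).
rewrite Cmult_1_l, Cexp_RtoC, exp_ln, Crising_1 by trivial.
change (fact (S n)) with (S n * fact n)%nat.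
rewrite mult_INR, S_INR, RtoC_mult, !RtoC_plus, RtoC_inv by lra.
field; auto using RtoC_fact_neq_0.
Qed.

Lemma rGamma_fact (n : nat) : rGamma (INR n + 1)%R = (/ INR (fact n))%C.
Proof.
induction n as [|n IH].
- simpl; rewrite Rplus_0_l, rGamma_1; field; apply RtoC_neq_0; lra.
- rewrite rGamma_rec, <- S_INR in IH.
  rewrite RtoC_plus.
  apply (Cmult_eq_reg_l (INR (S n))); [apply RtoC_INR_S_neq_0|].
  rewrite IH; change (fact (S n)) with (S n * fact n)%nat.
  rewrite mult_INR, RtoC_mult; field; auto using RtoC_fact_neq_0, RtoC_INR_S_neq_0.
Qed.

Lemma Gamma_fact (n : nat) : Gamma (INR n + 1)%R = RtoC (INR (fact n)).
Proof.
unfold Gamma; rewrite rGamma_fact; field; apply RtoC_fact_neq_0.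
Qed.

(** * The Beta integral *)

(** [cosint_shift] at [2 nu + 2 n], with both coefficients halved, supplies the next factors
    [nu + 1/2 + n] and [nu + 1 + n]. *)
Lemma cosint_Crising (nu : C) (n : nat) : - (1 / 2) < Re nu ->
  (Crising (nu + (1 / 2)%R) n * cosint (2 * nu) 0)%C =
  (Crising (nu + 1) n * cosint (2 * nu + INR (2 * n)) 0)%C.
Proof.
intros Hnu; induction n as [|n IH].
- simpl; rewrite Cplus_0_r; ring.
- change (Crising (nu + (1 / 2)%R) (S n))
    with (Crising (nu + (1 / 2)%R) n * (nu + (1 / 2)%R + INR n))%C.
  change (Crising (nu + 1) (S n)) with (Crising (nu + 1) n * (nu + 1 + INR n))%C.
  assert (H := cosint_shift (2 * nu + INR (2 * n))).
  replace (2 * nu + INR (2 * n) + 2)%C with (2 * nu + INR (2 * S n))%C in H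
    by (rewrite !mult_INR, (S_INR n), !RtoC_mult, !RtoC_plus; change (INR 2) with 2; ring).
  transitivity ((nu + (1 / 2)%R + INR n) * (Crising (nu + (1 / 2)%R) n * cosint (2 * nu) 0))%C;
    [ring|].
  rewrite IH.
  apply (Cmult_eq_reg_l 2); [apply RtoC_neq_0; lra|].
  transitivity (Crising (nu + 1) n * ((2 * nu + INR (2 * n) + 1) * cosint (2 * nu + INR (2 * n)) 0))%C.
  + rewrite mult_INR, RtoC_mult, RtoC_div by lra; change (INR 2) with 2; field.
  + rewrite H; [rewrite mult_INR, (S_INR n), RtoC_mult, RtoC_plus; change (INR 2) with 2; ring|].
    generalize (pos_INR (2 * n)); destruct nu; simpl in *; lra.
Qed.

Lemma rGamma_cosint_0 (nu : C) : - (1 / 2) < Re nu ->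
  (rGamma (nu + (1 / 2)%R) * cosint (2 * nu) 0)%C = (rGamma (nu + 1) * (sqrt PI / 2)%R)%C.
Proof.
intros Hnu.
assert (L1 : Cis_lim (fun n => gauss (nu + (1 / 2)%R) n * cosint (2 * nu) 0)%C
  (rGamma (nu + (1 / 2)%R) * cosint (2 * nu) 0))
  by (apply Cis_lim_mult; [apply gauss_lim|apply Cis_lim_const]).
assert (L2 : Cis_lim (fun n => gauss (nu + 1) n *
    (sqrt (INR n) * cosint (2 * nu + INR (2 * n + 2)) 0))%C
  (rGamma (nu + 1) * (sqrt PI / 2)%R)).
{ apply Cis_lim_mult; [apply gauss_lim|apply cosint_lim; destruct nu; simpl in *; lra]. }
rewrite <- (Cis_lim_unique _ _ L2); symmetry; apply Cis_lim_unique.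
revert L1; apply Cis_lim_ext_loc; exists 1%nat; intros n Hn.
assert (Pn : 0 < INR n) by (apply lt_0_INR; lia).
assert (Ps : RtoC (sqrt (INR n)) <> RtoC 0)
  by (apply RtoC_neq_0, Rgt_not_eq, sqrt_lt_R0; lra).
unfold gauss.
replace (Cexp ((nu + 1) * ln (INR n)))
  with (Cexp ((nu + (1 / 2)%R) * ln (INR n)) * sqrt (INR n))%C.
2: { replace (sqrt (INR n)) with (exp (/ 2 * ln (INR n)))
       by (change (Rpower (INR n) (/ 2) = sqrt (INR n)); now apply Rpower_sqrt).
  rewrite <- Cexp_RtoC, <- Cexp_plus; apply f_equal.
  destruct nu; apply injective_projections; simpl; field. }
(* Gauss's product at index [n] has [n + 1] rising factors, hence the shift by [2 n + 2]. *)
replace (2 * n + 2)%nat with (2 * S n)%nat by lia.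
transitivity ((Crising (nu + (1 / 2)%R) (S n) * cosint (2 * nu) 0) /
  (INR (fact n) * Cexp ((nu + (1 / 2)%R) * ln (INR n))))%C.
- unfold Cdiv; ring.
- rewrite cosint_Crising by trivial.
  field; repeat split; auto using Cexp_neq_0, RtoC_fact_neq_0.
Qed.

(** As [(2 s)! / (4 ^ s s!)] is [Gamma (s + 1/2) / sqrt PI], this is the Beta value
    [B(nu + 1/2, s + 1/2) / 2] cleared of Gamma at [nu + 1/2]. *)
Lemma rGamma_cosint (nu : C) (s : nat) : - (1 / 2) < Re nu ->
  (rGamma (nu + (1 / 2)%R) * cosint (2 * nu) s)%C =
  (rGamma (nu + INR s + 1) *
    (sqrt PI / 2 * (INR (fact (2 * s)) / (4 ^ s * INR (fact s))))%R)%C.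
Proof.
intros Hnu; induction s as [|s IH].
- rewrite rGamma_cosint_0 by trivial; simpl; rewrite Cplus_0_r.
  now replace (sqrt PI / 2 * (1 / (1 * 1))) with (sqrt PI / 2) by field.
- assert (H := cosint_sin_step (2 * nu) s).
  assert (Hs : (nu + INR s + 1)%C <> 0)
    by (apply Re_neq_0; generalize (pos_INR s); destruct nu; simpl in *; lra).
  assert (H2 : RtoC 2 <> 0) by (apply RtoC_neq_0; lra).
  apply (Cmult_eq_reg_l (2 * (nu + INR s + 1))); [now apply Cmult_neq_0|].
  transitivity (rGamma (nu + (1 / 2)%R) *
    ((2 * nu + (2 * INR s + 2)%R) * cosint (2 * nu) (S s)))%C.
  + rewrite RtoC_plus, RtoC_mult; ring.
  + rewrite H by (destruct nu; simpl in *; lra).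
    transitivity ((2 * INR s + 1)%R * (rGamma (nu + (1 / 2)%R) * cosint (2 * nu) s))%C; [ring|].
    rewrite IH, rGamma_rec.
    replace (nu + INR s + 1 + 1)%C with (nu + INR (S s) + 1)%C
      by (rewrite S_INR, RtoC_plus; ring).
    (* From [s] to [s + 1] the constant gains [(2 s + 2) (2 s + 1) / (4 (s + 1)) = (2 s + 1) /
       2]. *)
    replace (INR (fact (2 * S s))) with ((2 * INR s + 2) * ((2 * INR s + 1) * INR (fact (2 * s)))).
    2: { replace (2 * S s)%nat with (S (S (2 * s))) by lia; rewrite !fact_simpl, !mult_INR, !S_INR, mult_INR.
      change (INR 2) with 2; ring. }
    rewrite fact_simpl, mult_INR, <- tech_pow_Rmult.
    replace (sqrt PI / 2 * ((2 * INR s + 2) * ((2 * INR s + 1) * INR (fact (2 * s))) /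
      (4 * 4 ^ s * (INR (S s) * INR (fact s)))))
      with ((2 * INR s + 1) / 2 * (sqrt PI / 2 * (INR (fact (2 * s)) / (4 ^ s * INR (fact s))))).
    * rewrite !(RtoC_mult ((2 * INR s + 1) / 2)), RtoC_div by lra; field; trivial.
    * rewrite S_INR; field; repeat split; try apply INR_fact_neq_0; try (apply pow_nonzero; lra).
      generalize (pos_INR s); lra.
Qed.
(** * The terms of the series *)

Lemma Ccos_RtoC (t : R) : Ccos t = RtoC (cos t).
Proof.
unfold Ccos, Cexp; apply injective_projections; simpl.
all: replace (0 * t - 1 * 0) with 0 by ring; replace (0 * 0 + 1 * t) with t by ring.
all: rewrite Ropp_0, exp_0, cos_neg, sin_neg; field.
Qed.

Lemma Csin_RtoC (t : R) : Csin t = RtoC (sin t).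
Proof.
unfold Csin, Cexp; apply injective_projections; simpl.
all: replace (0 * t - 1 * 0) with 0 by ring; replace (0 * 0 + 1 * t) with t by ring.
all: rewrite Ropp_0, exp_0, cos_neg, sin_neg; field.
Qed.

(** On the open interval [cos t] is a positive real, where every admissible branch is the real
    logarithm. *)
Lemma is_CInt_Cpower_cos (log : C -> C) (z nu : C) (s : nat) :
  log_branch log -> - (1 / 2) < Re nu ->
  is_CInt (fun t => Cpower log (Ccos t) (2 * nu) * (z * Csin t) ^ (2 * s))%C 0 (PI / 2)
    (z ^ (2 * s) * cosint (2 * nu) s)%C.
Proof.
intros [_ [Hlog _]] Hnu.
assert (H := is_cosint_cosint (2 * nu) s); unfold is_cosint in H.
assert (K : -1 < Re (2 * nu)) by (destruct nu; simpl in *; lra).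
generalize (is_CInt_scal (z ^ (2 * s))%C _ _ _ _ (H K)).
apply is_CInt_ext; [generalize PI_RGT_0; lra|].
intros t Ht; assert (Hc : 0 < cos t) by (apply cos_gt_0; lra).
rewrite Ccos_RtoC, Csin_RtoC, Cpow_mult_l, RtoC_pow; unfold Cpower, cospow.
destruct (Ceq_dec (cos t) 0) as [E|_]; [apply RtoC_inj in E; lra|].
rewrite Hlog by trivial; ring.
Qed.

(** Since [|sin t| <= 1], the integral of [cos^(Re w)] is a majorant for all [s] at once. *)
Lemma Cmod_cosint_bounded (w : C) : -1 < Re w ->
  exists M, forall s, Cmod (cosint w s) <= M.
Proof.
intros Hw; exists (Re (cosint (Re w) 0)); intros s.
now apply Cmod_cosint_le; [|apply is_RInt_gen_exp_mult_ln_cos].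
Qed.

(** * Branches of the logarithm and the power of [z / 2] *)

Lemma Cexp_eq_1 (d : C) : Cexp d = RtoC 1 -> Rabs (Im d) < 2 * PI -> d = RtoC 0.
Proof.
intros E B; assert (M := Cmod_Cexp d); rewrite E, Cmod_1, <- exp_0 in M.
apply exp_inv in M; destruct d as [x y]; simpl in *; subst x.
apply (f_equal Re) in E; unfold Cexp in E; simpl in E; rewrite exp_0, Rmult_1_l in E.
apply Rabs_def2 in B.
assert (S : sin (y / 2) = 0).
{ assert (T := cos_2a_sin (y / 2)); replace (2 * (y / 2)) with y in T by field.
  rewrite E in T; nra. }
apply injective_projections; simpl; trivial.
destruct (total_order_T y 0) as [[L|L]|L]; trivial.
- assert (P := sin_gt_0 (- (y / 2))); rewrite sin_neg in P; lra.
- assert (P := sin_gt_0 (y / 2)); lra.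
Qed.

(** Both sides have the same exponential. Their imaginary parts lie in one half-open interval of
    length [2 PI], so they differ by less than a period. *)
Lemma log_branch_half (log : C -> C) (z : C) : log_branch log -> z <> RtoC 0 ->
  log (z / 2)%C = (log z - ln 2)%C.
Proof.
intros (Hexp & _ & a & Ha) Hz.
assert (H2 : RtoC 2 <> 0) by (apply RtoC_neq_0; lra).
assert (Hz2 : (z / 2)%C <> 0).
{ intros E; apply Hz; replace z with (2 * (z / 2))%C by (field; trivial).
  rewrite E; ring. }
enough (D : (log (z / 2) - (log z - ln 2))%C = 0).
{ replace (log (z / 2)%C) with (log (z / 2) - (log z - ln 2) + (log z - ln 2))%C by ring.
  rewrite D; ring. }
apply Cexp_eq_1.
- rewrite !Cexp_minus, Cexp_RtoC, exp_ln, !Hexp by (trivial; lra); field; auto.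
- destruct (log z) as [x y] eqn:E1; destruct (log (z / 2)%C) as [u v] eqn:E2.
  simpl; apply Rabs_def1; destruct Ha as [Ha|Ha]; generalize (Ha _ Hz) (Ha _ Hz2);
    rewrite E1, E2; simpl; lra.
Qed.

Lemma Cexp_INR_mult (n : nat) (z : C) : Cexp (INR n * z) = (Cexp z ^ n)%C.
Proof.
induction n as [|n IH].
- simpl; rewrite Cmult_0_l, Cexp_RtoC, exp_0; reflexivity.
- rewrite S_INR, RtoC_plus, Cpow_S, <- IH, <- Cexp_plus; apply f_equal; ring.
Qed.

Lemma Cpower_half (log : C -> C) (z nu : C) (s : nat) :
  log_branch log -> - (1 / 2) < Re nu ->
  Cpower log (z / 2) (nu + (2 * INR s)%R) =
  (Cpower log z nu / Cexp (nu * ln 2) * (z ^ (2 * s) / 4 ^ s))%C.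
Proof.
intros Hlog Hnu.
assert (H2 : RtoC 2 <> 0) by (apply RtoC_neq_0; lra).
destruct (Ceq_dec z 0) as [->|Hz].
(* At [z = 0] and [s = 0] both powers have exponent [nu] and agree. For [s > 0] the left exponent
   has positive real part, so the left side is 0, as is [z ^ (2 s)] on the right. *)
- unfold Cpower.
  destruct (Ceq_dec (0 / 2) 0) as [_|N]; [|elim N; field; trivial].
  destruct (Ceq_dec 0 0) as [_|N]; [|now elim N].
  destruct s as [|s].
  + simpl INR; rewrite Rmult_0_r, Cplus_0_r.
    destruct (Ceq_dec nu 0) as [->|_].
    * simpl; rewrite Cmult_0_l, Cexp_RtoC, exp_0; field; apply RtoC_neq_0; lra.
    * unfold Cdiv; ring.
  + destruct (Ceq_dec (nu + (2 * INR (S s))%R) 0) as [E|_].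
    * exfalso; apply (f_equal Re) in E; generalize (pos_INR s).
      rewrite S_INR in E; destruct nu; simpl in *; lra.
    * replace (2 * S s)%nat with (S (S (2 * s))) by lia.
      rewrite Cpow_S; unfold Cdiv; ring.
- unfold Cpower.
  destruct (Ceq_dec z 0) as [E|_]; [easy|].
  destruct (Ceq_dec (z / 2) 0) as [E|_].
  { elim Hz; replace z with (2 * (z / 2))%C by (field; trivial); rewrite E; ring. }
  rewrite log_branch_half by trivial.
  replace ((nu + (2 * INR s)%R) * (log z - ln 2))%C
    with ((nu * log z - nu * ln 2) + (INR (2 * s) * log z - INR (2 * s) * ln 2))%C.
  2: { rewrite mult_INR; change (INR 2) with 2; ring. }
  rewrite Cexp_plus, !Cexp_minus, !Cexp_INR_mult, Cexp_RtoC, exp_ln by lra.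
  destruct Hlog as [-> _]; trivial.
  replace (RtoC 2 ^ (2 * s))%C with (RtoC 4 ^ s)%C; [reflexivity|].
  rewrite Cpow_mult_r, <- (RtoC_pow 2 2); apply (f_equal (fun c => RtoC c ^ s)%C); ring.
Qed.

(** Because [/ 0 = 0], the inverse of [Gamma w] is [rGamma w] even where the latter vanishes. *)
Lemma Cdiv_mult_Gamma (x d w : C) : d <> 0 -> (x / (d * Gamma w))%C = (x / d * rGamma w)%C.
Proof.
intros Hd; unfold Gamma.
destruct (Ceq_dec (rGamma w) 0) as [->|H].
- assert (I0 : (/ 0)%C = 0)
    by (apply injective_projections; simpl; unfold Rdiv; rewrite ?Ropp_0; ring).
  unfold Cdiv; rewrite I0, Cmult_0_r, I0; ring.
- field; split; trivial.
Qed.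

Lemma Bessel_term_eq (log : C -> C) (z nu : C) (s : nat) :
  log_branch log -> - (1 / 2) < Re nu ->
  (((-1) ^ s)%R * rGamma (nu + INR s + 1) / INR (fact s)
     * Cpower log (z / 2) (nu + (2 * INR s)%R))%C =
  (Cpower log z nu / (Cpower log 2 (nu - 1) * sqrt PI * Gamma (nu + (1 / 2)%R))
     * (((-1) ^ s)%R / INR (fact (2 * s)) * (z ^ (2 * s) * cosint (2 * nu) s)))%C.
Proof.
intros Hlog Hnu; assert (Hpi := PI_RGT_0).
assert (H2 : RtoC 2 <> 0) by (apply RtoC_neq_0; lra).
assert (H4 : (4 ^ s)%C <> 0) by (apply Cpow_nz, RtoC_neq_0; lra).
assert (Hs : RtoC (sqrt PI) <> 0)
  by (apply RtoC_neq_0, Rgt_not_eq, sqrt_lt_R0; lra).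
assert (P2 : Cpower log 2 (nu - 1) = (Cexp (nu * ln 2) / 2)%C).
{ unfold Cpower; destruct (Ceq_dec 2 0) as [E|_]; [easy|].
  destruct Hlog as [_ [-> _]]; [|lra].
  replace ((nu - 1) * ln 2)%C with (nu * ln 2 - ln 2)%C by ring.
  rewrite Cexp_minus, Cexp_RtoC, exp_ln by lra; reflexivity. }
assert (HE := Cexp_neq_0 (nu * ln 2)).
rewrite Cpower_half, P2, Cdiv_mult_Gamma by
  (trivial; apply Cmult_neq_0; trivial; unfold Cdiv; apply Cmult_neq_0; trivial;
   intros E; apply (f_equal (Cmult 2)) in E; rewrite Cinv_r, Cmult_0_r in E; trivial;
   apply RtoC_inj in E; lra).
(* Regrouped to expose the left side of [rGamma_cosint]; afterwards [sqrt PI / 2] and [(2 s)!]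
   cancel, and [4 ^ s s!] is what the Bessel term requires. *)
transitivity (Cpower log z nu / (Cexp (nu * ln 2) / 2 * sqrt PI) * ((-1) ^ s)%R
  / INR (fact (2 * s)) * z ^ (2 * s) * (rGamma (nu + (1 / 2)%R) * cosint (2 * nu) s))%C.
- rewrite rGamma_cosint by trivial.
  rewrite RtoC_mult, RtoC_div, (RtoC_div (INR _)), (RtoC_mult (4 ^ s)), (RtoC_pow 4 s)
    by (try apply Rmult_integral_contrapositive_currified;
        try apply pow_nonzero; try apply INR_fact_neq_0; lra).
  field; repeat split; auto using RtoC_fact_neq_0.
- field; repeat split; auto using RtoC_fact_neq_0.
Qed.
(** * Summation *)

Definition Cis_series (a : nat -> C) (l : C) : Prop :=
  is_series (fun n => Re (a n)) (Re l) /\ is_series (fun n => Im (a n)) (Im l).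

Lemma Cis_series_unique (a : nat -> C) (l : C) : Cis_series a l -> CSeries a = l.
Proof.
intros [H1 H2]; unfold CSeries.
rewrite (is_series_unique _ _ H1), (is_series_unique _ _ H2); now destruct l.
Qed.

Lemma Cis_series_ext (a b : nat -> C) (l : C) :
  (forall n, a n = b n) -> Cis_series a l -> Cis_series b l.
Proof.
intros E [H1 H2]; split; [revert H1|revert H2]; apply is_series_ext; intros n; now rewrite E.
Qed.

Lemma Cis_series_plus (a b : nat -> C) (l m : C) :
  Cis_series a l -> Cis_series b m -> Cis_series (fun n => a n + b n)%C (l + m)%C.
Proof.
intros [H1 H2] [K1 K2]; split.
- exact (is_series_plus _ _ _ _ H1 K1).
- exact (is_series_plus _ _ _ _ H2 K2).
Qed.

Lemma Cis_series_scal (c : C) (a : nat -> C) (l : C) :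
  Cis_series a l -> Cis_series (fun n => c * a n)%C (c * l)%C.
Proof.
intros [H1 H2]; split; simpl.
- exact (is_series_minus _ _ _ _ (is_series_scal_l (fst c) _ _ H1)
    (is_series_scal_l (snd c) _ _ H2)).
- exact (is_series_plus _ _ _ _ (is_series_scal_l (fst c) _ _ H2)
    (is_series_scal_l (snd c) _ _ H1)).
Qed.

Lemma ex_Cis_series (a : nat -> C) (b : nat -> R) :
  (forall n, Cmod (a n) <= b n) -> ex_series b -> exists l, Cis_series a l.
Proof.
intros H Hb.
destruct (ex_series_le (V := R_CompleteNormedModule) (fun n => Re (a n)) b) as [x Hx]; trivial.
{ intros n; apply Rle_trans with (2 := H n); apply re_le_Cmod. }
destruct (ex_series_le (V := R_CompleteNormedModule) (fun n => Im (a n)) b) as [y Hy]; trivial.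
{ intros n; apply Rle_trans with (2 := H n); apply Rabs_Im_le_Cmod. }
now exists (x, y).
Qed.

Lemma ex_cosint_series (z w : C) : -1 < Re w -> exists l,
  Cis_series (fun s => ((-1) ^ s)%R / INR (fact (2 * s)) * (z ^ (2 * s) * cosint w s))%C l.
Proof.
intros Hw; destruct (Cmod_cosint_bounded w Hw) as [M HM].
assert (PM : 0 <= M) by (apply Rle_trans with (2 := HM 0%nat); apply Cmod_ge_0).
(* Weakening [(2 s)!] to [s!] makes the majorant the exponential series at [|z| ^ 2]. *)
apply ex_Cis_series with (fun s => M * ((Cmod z ^ 2) ^ s * / INR (fact s))).
- intros s; unfold Cdiv.
  rewrite !Cmod_mult, Cmod_inv, Cmod_pow, !Cmod_R, pow_1_abs, Rmult_1_l, pow_mult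
    by apply RtoC_fact_neq_0.
  rewrite (Rabs_pos_eq (INR _)) by apply pos_INR.
  set (p := (Cmod z ^ 2) ^ s).
  assert (Pp : 0 <= p) by apply pow_le, pow_le, Cmod_ge_0.
  assert (I : / INR (fact (2 * s)) <= / INR (fact s)).
  { apply Rinv_le_contravar; [apply INR_fact_lt_0|apply le_INR, fact_le; lia]. }
  assert (I0 : 0 < / INR (fact (2 * s))) by apply Rinv_0_lt_compat, INR_fact_lt_0.
  assert (Q := HM s); assert (Q0 := Cmod_ge_0 (cosint w s)).
  apply Rle_trans with (/ INR (fact s) * (p * M)); [|right; ring].
  apply Rmult_le_compat; [lra|now apply Rmult_le_pos|trivial|].
  now apply Rmult_le_compat_l.
- exists (M * exp (Cmod z ^ 2)).
  apply (is_series_scal_l (K := R_AbsRing) (V := R_NormedModule) M).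
  generalize (is_exp_Reals (Cmod z ^ 2)); unfold is_pseries; apply is_series_ext.
  intros n; rewrite pow_n_pow; reflexivity.
Qed.

Definition BCis_series (a : nat -> BC) (l : BC) : Prop :=
  Cis_series (fun n => fst (a n)) (fst l) /\ Cis_series (fun n => snd (a n)) (snd l).

Lemma BCis_series_unique (a : nat -> BC) (l : BC) : BCis_series a l -> BCSeries a = l.
Proof.
intros [H1 H2]; unfold BCSeries.
rewrite (Cis_series_unique _ _ H1), (Cis_series_unique _ _ H2); now destruct l.
Qed.

Lemma BCis_series_idem (a b : nat -> C) (l m : C) :
  Cis_series a l -> Cis_series b m ->
  BCis_series (fun n => BCidem (a n) (b n)) (BCidem l m).
Proof.
intros Ha Hb; rewrite BCidemE; split; cbn [fst snd].
- apply Cis_series_ext with (fun n => (1 / 2)%R * (a n + b n))%C;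
    [intros n; rewrite BCidemE; reflexivity|].
  now apply Cis_series_scal, Cis_series_plus.
- apply Cis_series_ext with (fun n => (1 / 2)%R * (Ci * (a n + - (1) * b n)))%C.
  { intros n; rewrite BCidemE; cbn [snd]; ring. }
  replace (l - m)%C with (l + - (1) * m)%C by ring.
  now apply Cis_series_scal, Cis_series_scal, Cis_series_plus, Cis_series_scal.
Qed.

Lemma BCis_series_ext (a b : nat -> BC) (l : BC) :
  (forall n, a n = b n) -> BCis_series a l -> BCis_series b l.
Proof.
intros E [H1 H2]; split; [revert H1|revert H2]; apply Cis_series_ext; intros n; now rewrite E.
Qed.

Lemma BCis_series_mult (A : BC) (a : nat -> BC) (l : BC) :
  BCis_series a l -> BCis_series (fun n => A * a n)%BC (A * l)%BC.
Proof.
intros [H1 H2]; split; simpl.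
- apply Cis_series_ext with (fun n => fst A * fst (a n) + - snd A * snd (a n))%C;
    [intros n; ring|].
  replace (_ - _)%C with (fst A * fst l + - snd A * snd l)%C by ring.
  now apply Cis_series_plus; apply Cis_series_scal.
- now apply Cis_series_plus; apply Cis_series_scal.
Qed.

Lemma BCis_series_ex (a : nat -> BC) (l : BC) : BCis_series a l -> ex_BCSeries a.
Proof.
intros [[H1 H2] [H3 H4]]; exists l.
intros P [eps HP].
assert (L1 := H1 _ (locally_ball _ eps)); assert (L2 := H2 _ (locally_ball _ eps)).
assert (L3 := H3 _ (locally_ball _ eps)); assert (L4 := H4 _ (locally_ball _ eps)).
unfold filtermap in *.
generalize (filter_and _ _ (filter_and _ _ L1 L2) (filter_and _ _ L3 L4)).
apply filter_imp; intros n [[B1 B2] [B3 B4]].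
(* Partial sums in the nested product are four real partial sums, and its balls are products of four
   real balls. *)
assert (E : forall m, sum_n a m =
  ((sum_n (fun s => Re (fst (a s))) m, sum_n (fun s => Im (fst (a s))) m),
   (sum_n (fun s => Re (snd (a s))) m, sum_n (fun s => Im (snd (a s))) m)) :> BC).
{ induction m as [|m IH].
  - rewrite !sum_O; now destruct (a 0%nat) as [[? ?] [? ?]].
  - rewrite !sum_Sn, IH; now destruct (a (S m)) as [[? ?] [? ?]]. }
apply HP; rewrite E; split; split; assumption.
Qed.

(** * Idempotent components as ring homomorphisms, and the main result *)

Lemma BC_eq (Z W : BC) : idem1 Z = idem1 W -> idem2 Z = idem2 W -> Z = W.
Proof. intros H1 H2; now rewrite <- (BCidem_repr Z), <- (BCidem_repr W), H1, H2. Qed.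

Lemma idem1_CtoBC (c : C) : idem1 (CtoBC c) = c.
Proof. unfold idem1, CtoBC; simpl; ring. Qed.

Lemma idem2_CtoBC (c : C) : idem2 (CtoBC c) = c.
Proof. unfold idem2, CtoBC; simpl; ring. Qed.

Lemma idem1_plus (Z W : BC) : idem1 (Z + W)%BC = (idem1 Z + idem1 W)%C.
Proof. unfold idem1, BCplus; simpl; ring. Qed.

Lemma idem2_plus (Z W : BC) : idem2 (Z + W)%BC = (idem2 Z + idem2 W)%C.
Proof. unfold idem2, BCplus; simpl; ring. Qed.

Lemma idem1_minus (Z W : BC) : idem1 (Z - W)%BC = (idem1 Z - idem1 W)%C.
Proof. unfold idem1, BCminus, BCplus, BCopp; simpl; ring. Qed.

Lemma idem2_minus (Z W : BC) : idem2 (Z - W)%BC = (idem2 Z - idem2 W)%C.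
Proof. unfold idem2, BCminus, BCplus, BCopp; simpl; ring. Qed.

Lemma idem1_div (Z W : BC) : idem1 (Z / W)%BC = (idem1 Z / idem1 W)%C.
Proof. unfold BCdiv, BCinv; now rewrite idem1_mult, idem1_BCidem. Qed.

Lemma idem2_div (Z W : BC) : idem2 (Z / W)%BC = (idem2 Z / idem2 W)%C.
Proof. unfold BCdiv, BCinv; now rewrite idem2_mult, idem2_BCidem. Qed.

Lemma idem1_pow (Z : BC) (n : nat) : idem1 (BCpow Z n) = (idem1 Z ^ n)%C.
Proof. induction n as [|n IH]; simpl; now rewrite ?idem1_CtoBC, ?idem1_mult, ?IH. Qed.

Lemma idem2_pow (Z : BC) (n : nat) : idem2 (BCpow Z n) = (idem2 Z ^ n)%C.
Proof. induction n as [|n IH]; simpl; now rewrite ?idem2_CtoBC, ?idem2_mult, ?IH. Qed.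

Create HintDb idem.
Hint Rewrite idem1_plus idem1_minus idem1_mult idem1_div idem1_pow idem1_CtoBC
  idem1_BCidem idem2_plus idem2_minus idem2_mult idem2_div idem2_pow idem2_CtoBC
  idem2_BCidem : idem.

Theorem theorem3p2 (log : C -> C) (Hlog : log_branch log) (Z V : BC)
  (HV : Re (fst V) + 1 / 2 > Rabs (Im (snd V))) :
  let integrand (s : nat) (t : BC) : BC :=
    (BCpower log (BCcos t) (CtoBC 2 * V) * BCpow (Z * BCsin t) (2 * s))%BC in
  let term (s : nat) : BC :=
    (CtoBC ((-1) ^ s)%R / CtoBC (Gamma (2 * INR s + 1)%R)
       * BCInt (integrand s) 0 (PI / 2) 0 (PI / 2))%BC in
  (forall s : nat, ex_BCInt (integrand s) 0 (PI / 2) 0 (PI / 2)) /\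
  ex_BCSeries term /\
  BesselJ log V Z =
    (BCpower log Z V
       / (BCpower log (CtoBC 2) (V - CtoBC 1) * CtoBC (sqrt PI)
            * BCGamma (V + CtoBC (1 / 2)%R))
       * BCSeries term)%BC.
Proof.
intros integrand term; assert (H0 : 0 < PI / 2) by (generalize PI_RGT_0; lra).
(* The real parts of [nu_1] and [nu_2] are [Re alpha_1 + Im alpha_2] and [Re alpha_1 - Im alpha_2],
   so [HV] says that both exceed [-1/2]. *)
assert (V1 : - (1 / 2) < Re (idem1 V)).
{ destruct V as [[a b] [c d]]; unfold idem1; simpl in *; generalize (Rle_abs (- d)).
  rewrite Rabs_Ropp; lra. }
assert (V2 : - (1 / 2) < Re (idem2 V)).
{ destruct V as [[a b] [c d]]; unfold idem2; simpl in *; generalize (Rle_abs d); lra. }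
assert (HI : forall s, is_BCInt (integrand s) 0 (PI / 2) 0 (PI / 2)
  (BCidem (idem1 Z ^ (2 * s) * cosint (2 * idem1 V) s)
     (idem2 Z ^ (2 * s) * cosint (2 * idem2 V) s))).
{ intros s; exists
    (fun t => Cpower log (Ccos t) (2 * idem1 V) * (idem1 Z * Csin t) ^ (2 * s))%C,
    (fun t => Cpower log (Ccos t) (2 * idem2 V) * (idem2 Z * Csin t) ^ (2 * s))%C,
    (idem1 Z ^ (2 * s) * cosint (2 * idem1 V) s)%C,
    (idem2 Z ^ (2 * s) * cosint (2 * idem2 V) s)%C.
  split; [|split; [now apply is_CInt_Cpower_cos|split; [now apply is_CInt_Cpower_cos|reflexivity]]].
  intros t1 t2 _ _; unfold integrand, BCpower, BCcos, BCsin.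
  apply BC_eq; now autorewrite with idem. }
set (a1 := fun s => (((-1) ^ s)%R / INR (fact (2 * s)) *
  (idem1 Z ^ (2 * s) * cosint (2 * idem1 V) s))%C).
set (a2 := fun s => (((-1) ^ s)%R / INR (fact (2 * s)) *
  (idem2 Z ^ (2 * s) * cosint (2 * idem2 V) s))%C).
assert (T : forall s, BCidem (a1 s) (a2 s) = term s).
(* Uniqueness replaces the value chosen by [epsilon] with the computed one. *)
{ intros s; unfold term; rewrite (BCInt_unique _ _ _ _ _ _ H0 H0 (HI s)).
  replace (2 * INR s) with (INR (2 * s)) by now rewrite mult_INR.
  rewrite Gamma_fact; apply BC_eq; now autorewrite with idem. }
destruct (ex_cosint_series (idem1 Z) (2 * idem1 V)) as [l1 Hl1].
{ destruct (idem1 V); simpl in *; lra. }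
destruct (ex_cosint_series (idem2 Z) (2 * idem2 V)) as [l2 Hl2].
{ destruct (idem2 V); simpl in *; lra. }
assert (S := BCis_series_ext _ _ _ T (BCis_series_idem _ _ _ _ Hl1 Hl2)).
split; [intros s; eexists; apply HI|split; [now apply BCis_series_ex with (1 := S)|]].
rewrite (BCis_series_unique _ _ S); unfold BesselJ; apply BCis_series_unique.
(* The Bessel series is, term by term, the prefactor times a convergent series, which gives its
   convergence together with its sum. *)
apply BCis_series_ext with (2 := BCis_series_mult _ _ _ S).
intros s; rewrite <- T; unfold BesselJ_term, BCpower, BCGamma, BCrGamma.
apply BC_eq; autorewrite with idem; symmetry; now apply Bessel_term_eq.
Qed.
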